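(* Let $n\ge2$ and suppose that $1\le p\le q\le (n-1)p'$, where $\frac1p+\frac1{p'}=1$ and $\frac1q+\frac1{q'}=1$. Then the Kakeya estimate $K(p\to q)$ and the bilinear Kakeya estimate $K^*(q'\times q'\to\frac{p'}{2})$ are equivalent.
   Context: Let $0<\delta\ll1$ be a small parameter. $A\lesssim B$ means that for every $\varepsilon>0$ there is a constant $C_\varepsilon$ independent of $\delta$ with $A\le C_\varepsilon\delta^{-\varepsilon}B$. All functions are non-negative. Let $\mathcal{E}$ be a $\delta$-net (maximal $\delta$-separated subset) of the cube $Q=[-1,1]^{n-1}\subset\mathbb{R}^{n-1}$. Equip $\mathcal{E}$ with two measures: counting measure $di$ and normalized counting measure $d\omega=\delta^{n-1}di$; $\mathcal{E}\times\mathcal{E}$ carries $d\omega\,di$. For $\omega,i\in\mathcal{E}$ let $$T_\omega^i=\{(\underline{y},y_n)\in\mathbb{R}^{n-1}\times\mathbb{R}:|y_n|\le1,\ |\underline{y}-y_n\omega-i|\le\delta\}.$$ For $f$ on $\mathbb{R}^n$ put $Xf(\omega,i)=\delta^{1-n}\int_{T_\omega^i}f(x)\,dx$, and for $g$ on $\mathcal{E}\times\mathcal{E}$ put $$X^*g(x)=\sum_{\omega\in\mathcal{E}}\sum_{i\in\mathcal{E}}g(\omega,i)\chi_{T_\omega^i}(x).$$ The mixed norm is $\|g\|_{L^{a}_\omega L^b_i}=\big\|\,\|g(\omega,\cdot)\|_{L^b(di)}\big\|_{L^a(d\omega)}$. For $1\le p,q\le\infty$, $K(p\to q)$ denotes the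 estimate (for all $f$ on $\mathbb{R}^n$) $$\|Xf\|_{L^q_\omega L^\infty_i}\lesssim\delta^{-\frac np+1}\|f\|_p .$$ $K^*(q'\times q'\to\frac{p'}2)$ denotes the estimate $$\|X^*f\,X^*g\|_{L^{p'/2}(\mathbb{R}^n)}\lesssim\delta^{-\frac{2n}{p}+2}\|f\|_{L^{q'}_\omega L^1_i}\|g\|_{L^{q'}_\omega L^1_i}$$ for all $f,g$ supported on $\mathcal{E}_1\times\mathcal{E}$ and $\mathcal{E}_2\times\mathcal{E}$ respectively, where $\mathcal{E}_1,\mathcal{E}_2$ are $O(1)$-separated subsets of $\mathcal{E}$, i.e. the distance between them is comparable to $1$ (implied constants may depend on the comparability constant). The exponent $p'/2$ may be less than $1$. The estimates are understood to hold for all small $\delta$ and all $\delta$-nets $\mathcal{E}$. *)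

(* Defs.v *)
From HB Require Import structures.
From mathcomp Require Import all_boot all_order all_algebra finmap.
From mathcomp Require Import all_classical all_reals all_analysis.

Set Implicit Arguments.
Unset Strict Implicit.
Unset Printing Implicit Defensive.

Import Order.TTheory GRing.Theory Num.Theory.
Import numFieldNormedType.Exports.

Local Open Scope classical_set_scope.
Local Open Scope ring_scope.

Lemma product_measure_sigma_finite d1 d2 (T1 : measurableType d1)
    (T2 : measurableType d2) (R : realType)
    (m1 : {sigma_finite_measure set T1 -> \bar R})
    (m2 : {sigma_finite_measure set T2 -> \bar R}) :
  sigma_finite [set: T1 * T2] (m1 \x m2)%E.
Proof.
have /sigma_finiteP[F [TF ndF Foo]] := sigma_finiteT m1.
have /sigma_finiteP[G [TG ndG Goo]] := sigma_finiteT m2.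
exists (fun n => F n `*` G n).
  rewrite -setXTT TF TG predeqE => -[x y]; split.
    move=> [/= [i _ Fix] [k _ Gky]]; exists (maxn i k) => //; split.
    - by move: x Fix; exact/subsetPset/ndF/leq_maxl.
    - by move: y Gky; exact/subsetPset/ndG/leq_maxr.
  by move=> [i _ []/= ? ?]; split; exists i.
move=> k; have [? ?] := Foo k; have [? ?] := Goo k.
split; first exact: measurableX.
by rewrite product_measure1E// lte_mul_pinfty// ge0_fin_numE.
Qed.

(* MathComp-Analysis has the Borel sigma-algebra on k-tuples but no Lebesgue
   measure there: it is built as the iterated product of the one on R. *)
Section lebesgue_tuple.
Context {R : realType}.
Local Notation mR := (measurableTypeR R).

Definition tuple_cons k (z : mR * k.-tuple mR) : k.+1.-tuple mR :=
  [the k.+1.-tuple mR of z.1 :: z.2].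

Definition tuple_uncons k (t : k.+1.-tuple mR) : mR * k.-tuple mR :=
  (thead t, [tuple of behead t]).

Lemma tuple_consK k : cancel (@tuple_cons k) (@tuple_uncons k).
Proof. by case=> x t; congr pair; apply/val_inj. Qed.

Lemma measurable_tuple_cons k : measurable_fun [set: _] (@tuple_cons k).
Proof. exact: measurable_cons. Qed.

Lemma measurable_tuple_uncons k : measurable_fun [set: _] (@tuple_uncons k).
Proof.
apply/measurable_fun_pair; first exact: measurable_tnth.
exact: measurable_behead.
Qed.

Section step.
Variables (k : nat) (mu : {sigma_finite_measure set (k.-tuple mR) -> \bar R}).

Definition lebesgue_cons : set (k.+1.-tuple mR) -> \bar R :=
  pushforward (lebesgue_measure \x mu)%E (@tuple_cons k).

Let lebesgue_cons0 : lebesgue_cons set0 = 0%E.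
Proof. by rewrite /lebesgue_cons /pushforward preimage_set0 measure0. Qed.

Let lebesgue_cons_ge0 A : (0 <= lebesgue_cons A)%E.
Proof. by rewrite /lebesgue_cons /pushforward; exact: measure_ge0. Qed.

Let lebesgue_cons_sigma_additive : semi_sigma_additive lebesgue_cons.
Proof.
move=> F mF tF mUF; rewrite /lebesgue_cons /pushforward preimage_bigcup.
have mpre A : measurable A -> measurable (@tuple_cons k @^-1` A).
  by move=> mA; rewrite -[X in measurable X]setTI; exact: measurable_tuple_cons.
apply: measure_semi_sigma_additive.
- by move=> i; exact: mpre.
- apply/trivIsetP => /= i j _ _ ij; rewrite -preimage_setI.
  by move/trivIsetP : tF => /(_ _ _ _ _ ij) ->//; rewrite preimage_set0.
- by rewrite -preimage_bigcup; exact: mpre.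
Qed.

HB.instance Definition _ := isMeasure.Build _ _ _ lebesgue_cons
  lebesgue_cons0 lebesgue_cons_ge0 lebesgue_cons_sigma_additive.

Let lebesgue_cons_sigma_finite : sigma_finite setT lebesgue_cons.
Proof.
have [F TF Foo] := product_measure_sigma_finite (@lebesgue_measure R) mu.
exists (fun i => @tuple_uncons k @^-1` F i).
  by rewrite -preimage_bigcup -TF preimage_setT.
move=> i; have [mF Fi] := Foo i; split.
  by rewrite -[X in measurable X]setTI; exact: measurable_tuple_uncons.
rewrite /lebesgue_cons /pushforward -comp_preimage.
rewrite (_ : _ \o _ = id) ?preimage_id//.
by apply/funext => z /=; rewrite tuple_consK.
Qed.

HB.instance Definition _ := Measure_isSigmaFinite.Build _ _ _ lebesgue_cons
  lebesgue_cons_sigma_finite.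

End step.

Fixpoint lebesgue_tuple (k : nat) :
    {sigma_finite_measure set (k.-tuple mR) -> \bar R} :=
  if k is k'.+1 then lebesgue_cons (lebesgue_tuple k') else \d_[tuple].

End lebesgue_tuple.

(* The n-dimensional objects below are indexed by m = n - 1: R^n is written
   R^(n-1) x R, with points (y, y_n). *)
Section kakeya_objects.
Context {R : realType} {m : nat}.
Local Notation vec := 'rV[R]_m.
Local Notation point := (m.-tuple (measurableTypeR R) * measurableTypeR R)%type.

Definition lebesgue_point : set point -> \bar R :=
  (lebesgue_tuple m \x lebesgue_measure)%E.

HB.instance Definition _ := Measure.on lebesgue_point.

(* The library's norm on 'rV[R]_m is the sup norm. *)
Definition enorm (v : vec) : R := Num.sqrt (\sum_(j < m) v 0 j ^+ 2).

Definition in_cube (v : vec) : Prop := forall j : 'I_m, -1 <= v 0 j <= 1.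

(* Maximality: no point of the cube can be added. Taking E finite loses
   nothing, a delta-separated subset of the cube being finite. *)
Definition delta_net (delta : R) (E : {fset vec}) : Prop :=
  [/\ forall v, v \in E -> in_cube v,
      forall v w, v \in E -> w \in E -> v != w -> delta <= enorm (v - w)
    & forall v, in_cube v ->
        (forall w, w \in E -> delta <= enorm (v - w)) -> v \in E].

Definition row_of_tuple (t : m.-tuple (measurableTypeR R)) : vec :=
  \row_j (tnth t j : R).

Definition tube (delta : R) (w i : vec) : set point :=
  [set y | `|y.2 : R| <= 1 /\
           enorm (row_of_tuple y.1 - (y.2 : R) *: w - i) <= delta].

Definition xray (delta : R) (f : point -> R) (w i : vec) : \bar R :=
  ((delta ^- m)%:E * \int[lebesgue_point]_(x in tube delta w i) (f x)%:E)%E.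

Definition xray_adj (delta : R) (E : {fset vec}) (g : vec -> vec -> R)
    (x : point) : R :=
  \sum_(w <- E) \sum_(i <- E) g w i * \1_(tube delta w i) x.

(* L^a norm on E of a non-negative h, 1 <= a <= +oo, each point of E having
   mass c > 0. *)
Definition net_norm (c : R) (E : {fset vec}) (a : \bar R) (h : vec -> \bar R)
    : \bar R :=
  if a is r%:E then ((c%:E * \sum_(v <- E) h v `^ r) `^ r^-1)%E
  else (\big[maxe/0]_(v <- E) h v)%E.

(* L^a_w L^b_i norm: i carries counting measure, w counting measure times
   delta^(n-1). *)
Definition mixed_norm (delta : R) (E : {fset vec}) (a b : \bar R)
    (g : vec -> vec -> \bar R) : \bar R :=
  net_norm (delta ^+ m) E a (fun w => net_norm 1 E b (g w)).

(* Inside the cube, which has bounded diameter, distance comparable to 1 just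
   means distance bounded below. *)
Definition sep_by (c : R) (E1 E2 : {fset vec}) : Prop :=
  forall w1 w2, w1 \in E1 -> w2 \in E2 -> c <= enorm (w1 - w2).

Definition supported_on (E1 : {fset vec}) (g : vec -> vec -> R) : Prop :=
  forall w i, w \notin E1 -> g w i = 0.

End kakeya_objects.

(* In both estimates the factor C * delta^(-eps), with C depending on eps but
   not on delta, renders the symbol <~ . *)

Definition kakeya_estimate (R : realType) (n : nat) (p q : \bar R) : Prop :=
  exists2 delta0 : R, 0 < delta0 &
  forall eps : R, 0 < eps -> exists2 C : R, 0 < C &
  forall (delta : R) (E : {fset 'rV[R]_n.-1}),
    0 < delta < delta0 -> delta_net delta E ->
  forall f : n.-1.-tuple (measurableTypeR R) * measurableTypeR R -> R,
    measurable_fun [set: _] f -> (forall x, 0 <= f x) ->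
  (mixed_norm delta E q +oo (xray delta f) <=
    (C * delta `^ (- eps) * delta `^ (1 - n%:R * fine (p^-1)))%:E *
    'N[lebesgue_point]_p[EFin \o f])%E.

(* K^*(q' x q' -> p'/2), with pc = p' and qc = q'. The constant may depend on the separation c. *)
Definition bilinear_kakeya_estimate (R : realType) (n : nat) (p q : \bar R)
    : Prop :=
  let pc := hoelder_conjugate p in
  let qc := hoelder_conjugate q in
  exists2 delta0 : R, 0 < delta0 &
  forall c eps : R, 0 < c -> 0 < eps -> exists2 C : R, 0 < C &
  forall (delta : R) (E E1 E2 : {fset 'rV[R]_n.-1}),
    0 < delta < delta0 -> delta_net delta E ->
    (E1 `<=` E)%fset -> (E2 `<=` E)%fset -> sep_by c E1 E2 ->
  forall f g : 'rV[R]_n.-1 -> 'rV[R]_n.-1 -> R,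
    (forall w i, 0 <= f w i) -> (forall w i, 0 <= g w i) ->
    supported_on E1 f -> supported_on E2 g ->
  ('N[lebesgue_point]_(pc / 2%:E)
      [(fun x => (xray_adj delta E f x * xray_adj delta E g x)%:E)] <=
    (C * delta `^ (- eps) * delta `^ (2 - 2 * n%:R * fine (p^-1)))%:E *
    mixed_norm delta E qc 1 (fun w i => (f w i)%:E) *
    mixed_norm delta E qc 1 (fun w i => (g w i)%:E))%E.

(* Main.v *)
Require Import Defs.
From mathcomp Require Import all_boot all_order all_algebra finmap.
From mathcomp Require Import all_classical all_reals all_analysis.
From mathcomp Require Import measurable_realfun ess_sup_inf.
From mathcomp Require Import zify ring lra.
Import Order.TTheory GRing.Theory Num.Theory.
Local Open Scope ring_scope.

(** Write [m = n - 1], [r = p'] and [s = q'].  By duality the Kakeya estimate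
    says that every weighted sum of tubes [F = X^* g] satisfies
    [int F `^ r <= A * mass g `^ (r / s)], where [mass g] is the [s]-th power of
    the mixed norm of [g] ([dual_of_kakeya], [kakeya_of_dual]).  In this form
    the bilinear estimate follows from the Cauchy-Schwarz inequality
    ([Lnorm_half], [bilinear_of_kakeya]).

    For the converse, fix a large integer [K] and cut the directions into cubes
    of side [1 / K].  At every point, [F] is bounded either by a dimensional
    constant times the contribution of a single cube, or by a constant depending
    on [K] times the geometric mean of the contributions of two cubes at
    distance at least [1 / K] ([powR_sum_dichotomy]).  The second alternative is
    what the bilinear estimate controls ([bilinear_far_pair]).  In the first,
    a shear followed by a magnification by [K] in the first [m] variables turns
    the tubes of width [d] with directions in that cube into tubes of width
    [K * d] with directions in a unit cube ([integral_cell_le]).  The hypothesis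
    [q <= (n - 1) p'] says precisely that, relative to the critical power of the
    scale, the magnification does not increase the constant ([powR_magnify]),
    and [p <= q], that is [s <= r], allows the cubes to be summed
    ([sum_mass_dirs]).  If [a d] denotes the best constant at scale [d] divided
    by the critical power of [d], this gives
    [a d <= C0 * a (K * d) + B * d `^ (- e)] with [C0] independent of [K].
    For [K `^ e >= 2 * C0] the bound [a d <= C * d `^ (- e)] then propagates from
    the scales near [1] to all smaller scales ([dual_estimate_of_bilinear]).
    Pieces are recombined by pigeonholing at each point instead of
    orthogonality, so it does not matter whether [r / 2] is below or above [1].

    Magnification does not preserve nets, and it spreads the translations over a
    large cube.  The dual estimate is therefore stated for separated directions
    and arbitrary finite families of translations.  Translations are first
    localized to a cube of half the size ([dual_estimate_localize]); there, the
    neighborhood of a tube is filled by tubes with translations in a net, and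
    separated directions extend to a net ([delta_net_extend]).

    For [p = 1], where [p'] and possibly [q] are infinite, both estimates hold
    because of the trivial bounds ([kakeya_endpoint], [bilinear_endpoint]); for
    [p > 1] the hypotheses force all the exponents to be finite and larger than
    [1]. *)

Set Implicit Arguments.
Unset Strict Implicit.
Unset Printing Implicit Defensive.

(** * Sums of powers *)

Section real_inequalities.
Context {R : realType}.
Implicit Types (t : R).

Lemma sum_powR_le (I : Type) (s : seq I) (P : pred I) (a : I -> R) t :
  1 <= t -> (forall i, 0 <= a i) ->
  \sum_(i <- s | P i) a i `^ t <= (\sum_(i <- s | P i) a i) `^ t.
Proof.
move=> t1 a0; have t0 : 0 < t by apply: lt_le_trans t1.
have S0 : 0 <= \sum_(i <- s | P i) a i by apply: sumr_ge0.
rewrite -mulr_powRB1// mulr_suml.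
elim: s S0 => [|x s IH]; first by rewrite !big_nil.
have S0' : 0 <= \sum_(i <- s | P i) a i by apply: sumr_ge0.
rewrite !big_cons; case: ifPn => Px; last exact: IH.
move=> S0; rewrite lerD//.
  rewrite -mulr_powRB1// ler_wpM2l//.
  by rewrite ge0_ler_powR ?nnegrE ?subr_ge0// lerDl.
apply: le_trans (IH S0') _; apply: ler_sum => i _; rewrite ler_wpM2l//.
by rewrite ge0_ler_powR ?nnegrE ?subr_ge0// lerDr.
Qed.

Lemma sum_le_size (I : eqType) (s : seq I) (a : I -> R) (b : R) :
  (forall i, i \in s -> a i <= b) -> \sum_(i <- s) a i <= (size s)%:R * b.
Proof.
move=> ab; rewrite big_seq (le_trans (ler_sum _ _ (G := fun=> b)))//.
by rewrite -big_seq big_const_seq count_predT iter_addr_0 mulr_natl.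
Qed.

Lemma powRVK (x t : R) : 0 <= x -> 0 < t -> (x `^ t^-1) `^ t = x.
Proof. by move=> x0 t0; rewrite -powRrM mulVf ?gt_eqF// powRr1. Qed.

Lemma powR_sqr_half (x t : R) : 0 <= x -> (x * x) `^ (t / 2) = x `^ t.
Proof.
by move=> x0; rewrite -expr2 -powR_mulrn// -powRrM mulrCA divff ?mulr1// pnatr_eq0.
Qed.

End real_inequalities.

(** * Counting separated points *)

Section counting.
Context {m : nat}.

(** The map to offsets from the corner [lo] is injective, with values in the
    functions from ['I_m] to ['I_L.+1]. *)
Lemma size_int_box (s : seq 'rV[int]_m) (lo : 'rV[int]_m) (L : nat) :
  uniq s -> (forall v, v \in s -> forall j, lo 0 j <= v 0 j <= lo 0 j + L%:Z) ->
  (size s <= L.+1 ^ m)%N.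
Proof.
move=> us sL; pose f (v : 'rV[int]_m) : {ffun 'I_m -> 'I_L.+1} :=
  [ffun j => inord (absz (v 0 j - lo 0 j)%R)].
have fE v j : v \in s -> (f v j)%:Z = v 0 j - lo 0 j.
  move=> /sL/(_ j)/andP[lv vl]; rewrite ffunE inordK; last first.
    by rewrite ltnS -lez_nat gez0_abs ?subr_ge0// lerBlDl.
  by rewrite gez0_abs ?subr_ge0.
have injf : {in s &, injective f}.
  move=> v w vs ws fvw; apply/rowP => j; apply/eqP.
  by rewrite -(inj_eq (addIr (- lo 0 j))) -!fE// fvw.
rewrite -(size_map f) -[leqRHS](_ : #|{: {ffun 'I_m -> 'I_L.+1}}| = _); last first.
  by rewrite card_ffun !card_ord.
by rewrite -(card_uniqP _) ?map_inj_in_uniq// max_card.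
Qed.

End counting.

Section packing.
Context {R : realType} {m : nat}.
Local Notation vec := 'rV[R]_m.
Implicit Types (v w : vec) (d : R).

Definition cell d (v : vec) : 'rV[int]_m := \row_j Num.floor (d * v 0 j).

Definition delta_separated d (s : seq vec) :=
  uniq s /\ forall v w, v \in s -> w \in s -> v != w -> d <= enorm (v - w).

Lemma enormZ d v : 0 <= d -> enorm (d *: v) = d * enorm v.
Proof.
move=> d0; rewrite /enorm; under eq_bigr do rewrite mxE exprMn.
by rewrite -mulr_sumr sqrtrM ?sqr_ge0// sqrtr_sqr ger0_norm.
Qed.

Lemma enormN v : enorm (- v) = enorm v.
Proof. by rewrite /enorm; under eq_bigr do rewrite mxE sqrrN. Qed.

Lemma coord_le_enorm v j : `|v 0 j| <= enorm v.
Proof.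
rewrite /enorm -sqrtr_sqr ler_sqrt ?sumr_ge0// => [|i _]; last exact: sqr_ge0.
by rewrite (bigD1 j)//= lerDl sumr_ge0// => i _; exact: sqr_ge0.
Qed.

Lemma enorm_lt v d : 0 < d -> (forall j, `|v 0 j| <= d / m.+1%:R) ->
  enorm v < d.
Proof.
move=> d0 vd; rewrite /enorm -[ltRHS]ger0_norm ?ltW// -sqrtr_sqr ltr_sqrt ?exprn_gt0//.
apply: (@le_lt_trans _ _ (\sum_(j < m) (d / m.+1%:R) ^+ 2)).
  apply: ler_sum => j _; rewrite -real_normK ?num_real// ler_sqr// ?nnegrE//.
  by rewrite divr_ge0// ltW.
rewrite sumr_const card_ord exprMn -mulrnAr gtr_pMr ?exprn_gt0//.
rewrite -[_ *+ m]mulr_natl exprVn ltr_pdivrMr ?exprn_gt0// mul1r -natrX ltr_nat.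
by rewrite (leq_trans (ltnSn m))// expnS leq_pmulr // expn_gt0.
Qed.

Lemma floor_lt_cell (x y d : R) : 0 < d -> Num.floor (d * x) = Num.floor (d * y) ->
  `|x - y| < d^-1.
Proof.
move=> d0 xy; have := floor_itv (d * x); have := floor_itv (d * y).
rewrite xy intrD => /andP[y1 y2] /andP[x1 x2].
rewrite -(ltr_pM2l d0) mulfV ?gt_eqF// -[X in X * _]ger0_norm ?ltW// -normrM.
by rewrite mulrBr ltr_norml; apply/andP; split; lra.
Qed.

(** Distinct points of a separated family lie in distinct cells of a grid whose
    mesh is a dimensional fraction of the separation, so the points can be
    counted by counting grid cells. *)
Lemma separated_size_le (d : R) (s : seq vec) (c : vec) (L : nat) :
  0 < d -> delta_separated d s ->
  (forall v, v \in s -> forall j, `|v 0 j - c 0 j| <= L%:R * d) ->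
  (size s <= (2 * m.+1 * L).+2 ^ m)%N.
Proof.
move=> d0 [us sepd] sL; pose k := m.+1%:R / d.
have k0 : 0 < k by rewrite divr_gt0.
rewrite -(size_map (cell k)).
apply: (@size_int_box _ _ (\row_j Num.floor (k * (c 0 j - L%:R * d)))).
- rewrite map_inj_in_uniq// => v w vs ws /rowP vw; apply/eqP/negPn/negP => neq.
  have := sepd _ _ vs ws neq; rewrite leNgt => /negP; apply.
  apply: enorm_lt => // j; rewrite !mxE ltW//.
  have := vw j; rewrite !mxE => /(floor_lt_cell k0).
  by rewrite /k invf_div.
- move=> _ /mapP[v vs ->] j; rewrite !mxE.
  have := sL _ vs j; rewrite ler_norml => /andP[h1 h2].
  rewrite le_floor ?ler_pM2l//=; last by lra.
  rewrite -ltzD1 floor_lt_int.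
  set x := k * (c 0 j - L%:R * d).
  have kd : k * d = m.+1%:R by rewrite /k divfK ?gt_eqF.
  have vx : k * v 0 j <= x + 2 * m.+1%:R * L%:R.
    have : k * v 0 j <= k * (c 0 j + L%:R * d) by rewrite ler_pM2l//; lra.
    move/le_trans; apply; rewrite /x -kd le_eqVlt; apply/orP; left; apply/eqP; ring.
  have e : ((2 * m.+1 * L).+1)%:~R = 2 * m.+1%:R * L%:R + 1 :> R.
    by rewrite -pmulrn -addn1 natrD !natrM.
  by have := floorD1_gt x; rewrite !intrD e => hx; lra.
Qed.

(** With [L] about [1 / d] in [separated_size_le], the count is of order
    [d ^- m]: this bounds the normalized counting measure. *)
Lemma separated_cube_size (d : R) (s : seq vec) : 0 < d <= 1 -> delta_separated d s ->
  (forall v, v \in s -> in_cube v) -> (size s)%:R * d ^+ m <= (4 * m + 6)%:R ^+ m.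
Proof.
move=> /andP[d0 d1] sepd sQ.
(* [L * d] lies between [1] and [2] *)
pose L := (Num.truncn d^-1).+1.
have Ld : 1 <= L%:R * d.
  by rewrite -ler_pdivrMr// mul1r ltW// truncnS_gt.
have Ld2 : L%:R * d <= 2.
  have : L%:R <= d^-1 + 1.
    by rewrite /L -addn1 natrD lerD2r truncn_le invr_ge0 ltW.
  by rewrite -(ler_pM2r d0) mulrDl mulVf ?gt_eqF// mul1r; lra.
have : (size s <= (2 * m.+1 * L).+2 ^ m)%N.
  apply: (@separated_size_le d s 0) => // v /sQ vQ j.
  by rewrite mxE subr0 (le_trans _ Ld)// ler_norml; exact: vQ.
rewrite -(ler_nat R) natrX => h.
rewrite (@le_trans _ _ ((2 * m.+1 * L).+2%:R ^+ m * d ^+ m))//.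
  by rewrite ler_wpM2r// exprn_ge0// ltW.
rewrite -exprMn lerXn2r// ?nnegrE ?mulr_ge0// ?(ltW d0)//.
rewrite -addn2 natrD !natrM -addn1 natrD mulrDl natrD natrM.
have : (m%:R + 1) * (L%:R * d) <= (m%:R + 1) * 2 :> R.
  by rewrite ler_wpM2l.
lra.
Qed.

Lemma enorm0 : enorm (0 : vec) = 0.
Proof.
by rewrite /enorm big1 ?sqrtr0// => j _; rewrite mxE expr0n.
Qed.

Lemma delta_net_separated (d : R) (E : {fset vec}) : delta_net d E ->
  delta_separated d E.
Proof. by case=> _ sepE _; split; [exact: fset_uniq|exact: sepE]. Qed.

(** If no point of the net were within [d] of [u], maximality would put [u]
    itself into the net. *)
Lemma delta_net_near (d : R) (E : {fset vec}) u : 0 <= d -> delta_net d E ->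
  in_cube u -> exists2 i, i \in E & enorm (u - i) <= d.
Proof.
move=> d0 [_ _ maxE] uQ; apply: contrapT => no.
apply: (no); exists u; last by rewrite subrr enorm0.
apply: maxE => // w wE; rewrite leNgt; apply/negP => uw; apply: no.
by exists w => //; exact: ltW.
Qed.

(** The packing bound caps the size of separated families, so a largest one
    containing [s] exists, and it is maximal. *)
Lemma delta_net_extend (d : R) (s : seq vec) : 0 < d <= 1 -> delta_separated d s ->
  (forall v, v \in s -> in_cube v) ->
  exists2 E : {fset vec}, delta_net d E & {subset s <= E}.
Proof.
move=> d01 sepd sQ; have /andP[d0 _] := d01.
pose P (k : nat) := `[< exists t : seq vec, [/\ delta_separated d t,
  (forall v, v \in t -> in_cube v), {subset s <= t} & size t = k] >].
have exP : exists k, P k.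
  by exists (size s); apply/asboolP; exists s; split.
pose M := (4 * m + 6)%:R ^+ m / d ^+ m.
have leP k : P k -> (k <= Num.truncn M)%N.
  move=> /asboolP[t [sept tQ _ <-]]; rewrite -ltnS -(ltr_nat R).
  rewrite (le_lt_trans _ (truncnS_gt M))// ler_pdivlMr ?exprn_gt0//.
  exact: separated_cube_size.
case: (ex_maxnP exP leP) => _ /asboolP[t [sept tQ st <-]] tmax.
exists [fset v in t]%fset; last by move=> v /st; rewrite !inE.
case: (sept) => ut septd; split.
- by move=> v; rewrite inE; exact: tQ.
- by move=> v w; rewrite !inE; exact: septd.
- move=> v vQ vt; rewrite inE/=; apply/negPn/negP => vnt.
  have /tmax : P (size t).+1; last by rewrite ltnn.
  apply/asboolP; exists (v :: t); split => //.
  + split; first by rewrite /= vnt.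
    have tv w : w \in t -> d <= enorm (v - w) by move=> wt; apply: vt; rewrite inE.
    move=> a b; rewrite !inE => /predU1P[->|at_] /predU1P[->|bt] ab.
    * by rewrite eqxx in ab.
    * exact: tv.
    * by rewrite -enormN opprB; exact: tv.
    * exact: septd.
  + by move=> w; rewrite inE => /predU1P[->//|/tQ].
  + by move=> w /st wt; rewrite inE wt orbT.
Qed.

End packing.

(** * Affine changes of variables for Lebesgue measure *)

Section affine_change.
Context {R : realType}.
Local Open Scope classical_set_scope.
Local Open Scope ring_scope.
Local Notation mR := (measurableTypeR R).
Local Notation leb := (@lebesgue_measure R).

Lemma measurable_affine (K b : R) :
  measurable_fun [set: mR] (fun z : mR => K * z + b : mR).
Proof. by apply: measurable_funD => //; exact: measurable_funM. Qed.

(** Lebesgue measure is determined by its values on half-open intervals, where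
    the formula is a computation of lengths. *)
Lemma lebesgue_measure_affine (K b : R) (A : set mR) : 0 < K -> measurable A ->
  leb ((fun z : mR => K * z + b : mR) @^-1` A) = ((K^-1)%:E * leb A)%E.
Proof.
move=> K0 mA; have K0' : 0 <= K by exact: ltW.
pose f := fun z : mR => K * z + b : mR.
have mf : measurable_fun setT f by exact: measurable_affine.
have -> : leb A = (K%:E * leb (f @^-1` A))%E.
  have := @lebesgue_measure_unique R (mscale (NngNum K0') (pushforward leb f)).
  move=> /(_ mf) H; apply: (H _ A mA) => {H} _ [[x y] _ <-].
  have fxy : f @^-1` `]x, y]%classic = `](x - b) / K, (y - b) / K]%classic.
    apply/seteqP; split => z /=; rewrite !in_itv/= /f ltr_pdivrMr// ler_pdivlMr//;
      by rewrite [z * K]mulrC ltrBlDr lerBrDr.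
  change (leb `]x, y] = (K%:E * leb (f @^-1` `]x, y]%classic))%E).
  rewrite fxy !lebesgue_measure_itv/= !lte_fin ltr_pM2r ?invr_gt0// ltrD2r.
  case: ifPn => // _; rewrite ?mule0// -!EFinB -EFinM; congr EFin.
  by field; rewrite gt_eqF.
rewrite muleA -EFinM mulVf ?gt_eqF// mul1e.
by [].
Qed.

Lemma integral_affine (K b : R) (h : mR -> \bar R) : 0 < K ->
  measurable_fun [set: mR] h -> (forall z, 0 <= h z)%E ->
  (\int[leb]_z h (K * z + b)%R = (K^-1)%:E * \int[leb]_z h z)%E.
Proof.
move=> K0 mh h0; have K0' : 0 <= K^-1 by rewrite invr_ge0 ltW.
rewrite -(ge0_integral_mscale leb measurableT (NngNum K0'))//.
have mf := measurable_affine K b.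
rewrite -[LHS](ge0_integral_pushforward mf leb measurableT mh)//.
apply: eq_measure_integral => A mA _; rewrite /= /mscale /=.
exact: lebesgue_measure_affine.
Qed.

Definition dil k (K : R) (b : 'I_k -> R) (t : k.-tuple mR) : k.-tuple mR :=
  [tuple K * (tnth t j : R) + b j : mR | j < k].

Lemma dil_cons k (K : R) (b : 'I_k.+1 -> R) z (t : k.-tuple mR) :
  dil K b (tuple_cons (z, t)) =
  tuple_cons (K * z + b ord0 : mR, dil K (b \o lift ord0) t).
Proof.
apply: eq_from_tnth => j; rewrite tnth_mktuple.
have [i ->|->] := unliftP ord0 j; last by rewrite !tnth0.
by rewrite !tnthS tnth_mktuple.
Qed.

Lemma measurable_dil k (K : R) (b : 'I_k -> R) : measurable_fun setT (dil K b).
Proof.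
apply/measurable_fun_tnthP => j.
rewrite (_ : _ \o _ = (fun z : mR => K * z + b j : mR) \o (tnth (T:=mR))^~ j); last first.
  by apply/funext => t /=; rewrite tnth_mktuple.
apply: measurableT_comp; [exact: measurable_affine|exact: measurable_tnth].
Qed.

(** Slice along the first coordinate: the induction hypothesis rescales the
    slices, and [integral_affine] the variable that labels them. *)
Lemma lebesgue_tuple_dil k (K : R) (b : 'I_k -> R) (A : set (k.-tuple mR)) :
  0 < K -> measurable A ->
  lebesgue_tuple k (dil K b @^-1` A) = ((K ^- k)%:E * lebesgue_tuple k A)%E.
Proof.
move=> K0; elim: k b A => [|k IH] b A mA.
  rewrite expr0 invr1 mul1e /=; congr dirac.
  by apply/seteqP; split => t /=; rewrite (tuple0 (dil K b t)) (tuple0 t).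
rewrite /= /lebesgue_cons /pushforward /product_measure1.
pose B := @tuple_cons R k @^-1` A.
have mB : measurable B.
  by rewrite -[B]setTI; exact: measurable_tuple_cons.
pose h z := lebesgue_tuple k (xsection B z).
have mh : measurable_fun [set: mR] h by exact: measurable_fun_xsection.
transitivity (\int[leb]_z ((K ^- k)%:E * h (K * z + b ord0)%R)%E)%E.
  apply: eq_integral => z _ /=.
  rewrite -(IH (b \o lift ord0)); last exact: measurable_xsection.
  congr (lebesgue_tuple k _); apply/seteqP; split => t /=;
    by rewrite /xsection /= !inE /B /= dil_cons.
rewrite ge0_integralZl//; last 2 first.
- by apply: measurableT_comp mh _; exact: measurable_affine.
- by rewrite lee_fin invr_ge0 exprn_ge0// ltW.
rewrite integral_affine// muleA -EFinM -invfM -exprSr.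
by [].
Qed.

Lemma integral_tuple_dil k (K : R) (b : 'I_k -> R) (h : k.-tuple mR -> \bar R) :
  0 < K -> measurable_fun [set: k.-tuple mR] h -> (forall t, 0 <= h t)%E ->
  (\int[lebesgue_tuple k]_t h (dil K b t) =
   (K ^- k)%:E * \int[lebesgue_tuple k]_t h t)%E.
Proof.
move=> K0 mh h0; have K0' : 0 <= K ^- k by rewrite invr_ge0 exprn_ge0// ltW.
rewrite -(ge0_integral_mscale (lebesgue_tuple k) measurableT (NngNum K0'))//.
have mf := measurable_dil K b.
rewrite -[LHS](ge0_integral_pushforward mf (lebesgue_tuple k) measurableT mh)//.
apply: eq_measure_integral => A mA _; rewrite /= /mscale /=.
exact: lebesgue_tuple_dil.
Qed.

Definition shear k (K : R) (b : mR -> 'I_k -> R) (y : k.-tuple mR * mR) :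
  k.-tuple mR * mR := (dil K (b y.2) y.1, y.2).

(** Integrate first over the tuple with the last coordinate fixed: there the
    shear is an affine map of Jacobian [K ^+ k]. *)
Lemma integral_shear k (K : R) (b : mR -> 'I_k -> R)
    (h : k.-tuple mR * mR -> \bar R) :
  0 < K -> measurable_fun setT (shear K b) ->
  measurable_fun setT h -> (forall y, 0 <= h y)%E ->
  (\int[lebesgue_point]_y h (shear K b y) =
   (K ^- k)%:E * \int[lebesgue_point]_y h y)%E.
Proof.
move=> K0 ms mh h0.
have mhs : measurable_fun setT (fun y => h (shear K b y)).
  exact: measurableT_comp.
rewrite /lebesgue_point !fubini_tonelli2//.
rewrite -ge0_integralZl//; last 3 first.
- exact: measurable_fun_fubini_tonelli_G.
- by move=> z _; apply: integral_ge0.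
- by rewrite lee_fin invr_ge0 exprn_ge0// ltW.
apply: eq_integral => z _; rewrite /fubini_G/=.
rewrite -(integral_tuple_dil (b z))//.
exact: measurableT_comp.
Qed.

Definition box k (L : R) : set (k.-tuple mR) :=
  [set t | forall j, `|tnth t j : R| <= L].
Arguments box : clear implicits.

Lemma measurable_box k (L : R) : measurable (box k L).
Proof.
rewrite (_ : box k L =
    \bigcap_(j in [set: 'I_k]) ((fun t : k.-tuple mR => tnth t j) @^-1` `[- L, L])); last first.
  apply/seteqP; split => [t tL j _ /=|t tL j].
    by rewrite in_itv/= -ler_norml.
  by have := tL j I; rewrite /= in_itv/= -ler_norml.
apply: fin_bigcap_measurable => // j _.
rewrite -[X in measurable X]setTI; exact: measurable_tnth.
Qed.

Lemma lebesgue_tuple_box k (L : R) : (lebesgue_tuple k (box k L) < +oo)%E.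
Proof.
elim: k => [|k IH]; first by rewrite /= /dirac indicE ltry.
rewrite /= /lebesgue_cons /pushforward.
rewrite (_ : _ @^-1` _ = `[- L, L] `*` box k L); last first.
  apply/seteqP; split => [[z t] /= zt|[z t] /= [zL tL] j].
    split; first by have := zt ord0; rewrite tnth0 /= in_itv/= -ler_norml.
    by move=> j; have := zt (lift ord0 j); rewrite tnthS.
  have [i ->|->] := unliftP ord0 j; first by rewrite tnthS; exact: tL.
  by rewrite tnth0 /= ler_norml; rewrite in_itv in zL.
rewrite product_measure1E//; last exact: measurable_box.
rewrite lte_mul_pinfty//.
  by rewrite /= lebesgue_measure_itv/=; case: ifPn.
Qed.

Definition slab k (L : R) : set (k.-tuple mR * mR) :=
  box k L `*` [set z : mR | `|z : R| <= 1].
Arguments slab : clear implicits.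

Let norm_le1E : [set z : mR | `|z : R| <= 1] = `[-1, 1]%classic.
Proof. by apply/seteqP; split => z /=; rewrite in_itv/= ler_norml. Qed.

Lemma measurable_slab k (L : R) : measurable (slab k L).
Proof. by apply: measurableX; [exact: measurable_box|rewrite norm_le1E]. Qed.

Lemma lebesgue_slab k (L : R) : (lebesgue_point (slab k L) < +oo)%E.
Proof.
rewrite /slab norm_le1E /lebesgue_point product_measure1E//; last first.
  exact: measurable_box.
rewrite lte_mul_pinfty//.
  by rewrite ge0_fin_numE//; exact: lebesgue_tuple_box.
by rewrite /= lebesgue_measure_itv/=; case: ifPn => // _; rewrite -EFinD ltry.
Qed.

Lemma measurable_shear k (K : R) (b : mR -> 'I_k -> R) :
  (forall j, measurable_fun setT (fun z : mR => b z j : mR)) ->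
  measurable_fun setT (shear K b).
Proof.
move=> mb; apply/measurable_fun_pair => //; apply/measurable_fun_tnthP => j.
rewrite (_ : _ \o _ = fun y => K * (tnth y.1 j : R) + b y.2 j : mR); last first.
  by apply/funext => y /=; rewrite tnth_mktuple.
apply: measurable_funD; last exact: measurableT_comp (mb j) _.
apply: measurable_funM => //.
by apply: measurableT_comp (measurable_tnth j) _.
Qed.

End affine_change.
Arguments slab {R} k L _.

(** * Sums of tubes and the dual estimate *)

Section tubes.
Context {R : realType} {m : nat}.
Local Open Scope classical_set_scope.
Local Open Scope ring_scope.
Local Notation mR := (measurableTypeR R).
Local Notation vec := 'rV[R]_m.
Local Notation point := (m.-tuple mR * mR)%type.
Implicit Types (w i v : vec) (d r s : R) (Om I : seq vec) (g : vec -> vec -> R) (y : point).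

Lemma tube_coord d w i y j : tube d w i y ->
  `|(tnth y.1 j : R) - (y.2 : R) * w 0 j - i 0 j| <= d.
Proof.
move=> [_]; apply: le_trans; rewrite (le_trans _ (coord_le_enorm _ j))//.
by rewrite !mxE.
Qed.

Lemma measurable_tube d w i : measurable (tube d w i).
Proof.
pose f y : mR := enorm (row_of_tuple y.1 - (y.2 : R) *: w - i).
have mf : measurable_fun setT f.
  rewrite (_ : f = fun y =>
    (\sum_(j < m) ((tnth y.1 j : R) - (y.2 : R) * w 0 j - i 0 j) ^+ 2) `^ 2^-1); last first.
    apply/funext => y; rewrite powR12_sqrt ?sumr_ge0// => [|j _]; last exact: sqr_ge0.
    by rewrite /f /enorm; under eq_bigr do rewrite !mxE.
  apply: (@measurableT_comp _ _ _ _ _ _ (@powR R ^~ 2^-1)) => //.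
  apply: measurable_sum => j; apply: measurable_funX.
  apply: measurable_funB => //; apply: measurable_funB.
    exact: (measurableT_comp (measurable_tnth j)).
  exact: measurable_funM.
rewrite (_ : tube d w i = (snd @^-1` `[-1, 1]) `&` (f @^-1` `]-oo, d])).
  by apply: measurableI; [rewrite -[X in measurable X]setTI; exact: measurable_snd|
    rewrite -[X in measurable X]setTI; exact: mf].
by apply/seteqP; split => y /=; rewrite /tube /= !in_itv/= ler_norml /f.
Qed.

Definition tube_sum d Om I g y : R :=
  \sum_(w <- Om) \sum_(i <- I) g w i * \1_(tube d w i) y.

Lemma measurable_tube_sum d Om I g : measurable_fun setT (tube_sum d Om I g : point -> mR).
Proof.
apply: measurable_sum => w; apply: measurable_sum => i; apply: measurable_funM => //.
by apply: measurable_indic; exact: measurable_tube.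
Qed.

Lemma tube_sum_ge0 d Om I g y : (forall w i, 0 <= g w i) -> 0 <= tube_sum d Om I g y.
Proof. by move=> g0; do 2 (apply: sumr_ge0 => ? _); rewrite mulr_ge0. Qed.

Lemma tube_sum_le d Om I g y : (forall w i, 0 <= g w i) ->
  tube_sum d Om I g y <= \sum_(w <- Om) \sum_(i <- I) g w i.
Proof.
by move=> g0; do 2 (apply: ler_sum => ? _); rewrite -[leRHS]mulr1 ler_wpM2l.
Qed.

Lemma tube_sum_neq0 d Om I g y : tube_sum d Om I g y != 0 ->
  exists w i, [/\ w \in Om, i \in I & tube d w i y].
Proof.
move=> /eqP h; apply: contrapT => no; apply: h.
rewrite /tube_sum big_seq big1// => w wOm; rewrite big_seq big1// => i iI.
rewrite indicE memNset ?mulr0// => ty; apply: no.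
by exists w, i.
Qed.

(** The change of variables [shear] magnifies by [K] and brings the direction
    [k / K] to the vertical one and the translation [a / K] to the origin:
    tubes of width [d] become tubes of width [K * d]. *)
Definition untilt (K : R) (k a : vec) : point -> point :=
  shear K (fun z j => - ((z : R) * k 0 j) - a 0 j).

Lemma measurable_untilt K k a : measurable_fun setT (untilt K k a).
Proof.
apply: measurable_shear => j; apply: measurable_funB => //.
by apply: measurableT_comp => //; exact: measurable_funM.
Qed.

Lemma tube_untilt d K k a w i y : 0 < K ->
  tube (K * d) (K *: w - k) (K *: i - a) (untilt K k a y) <-> tube d w i y.
Proof.
move=> K0; rewrite /tube /= (_ : _ - _ - (K *: i - a) =
  K *: (row_of_tuple y.1 - (y.2 : R) *: w - i)).
  by rewrite enormZ ?(ltW K0)// ler_pM2l.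
by apply/rowP => j; rewrite !mxE tnth_mktuple; ring.
Qed.

Lemma tube_sum_untilt d K k a Om I g y : 0 < K ->
  tube_sum d Om I g y =
  tube_sum (K * d) [seq K *: w - k | w <- Om] [seq K *: i - a | i <- I]
    (fun w i => g (K^-1 *: (w + k)) (K^-1 *: (i + a))) (untilt K k a y).
Proof.
move=> K0; rewrite /tube_sum big_map; apply: eq_bigr => w _.
rewrite big_map; apply: eq_bigr => i _.
rewrite !subrK !scalerA mulVf ?gt_eqF// !scale1r; congr (_ * _).
rewrite !indicE; congr ((_ : bool)%:R); apply/idP/idP; rewrite !inE => h.
  exact/tube_untilt.
exact: (tube_untilt d k a w i y K0).1.
Qed.

(** For a net [Om = I = E], the [s]-th power of the [L^s_w L^1_i] norm of [g]. *)
Definition mass d s Om I g : R :=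
  d ^+ m * \sum_(w <- Om) (\sum_(i <- I) g w i) `^ s.

(** The estimate dual to the Kakeya estimate, raised to the power [r].  The
    directions only have to be separated and the translations are an arbitrary
    list, a form stable under [untilt]; [P] confines the translations. *)
Definition dual_estimate (P : vec -> Prop) d r s (A : R) : Prop :=
  forall Om I g, delta_separated d Om -> (forall w, w \in Om -> in_cube w) ->
  (forall i, i \in I -> P i) -> (forall w i, 0 <= g w i) ->
  (\int[lebesgue_point]_y (tube_sum d Om I g y `^ r)%:E <=
    (A * mass d s Om I g `^ (r / s))%:E)%E.

Lemma measurable_tube_sum_powR d r Om I g :
  measurable_fun setT (fun y => (tube_sum d Om I g y `^ r)%:E).
Proof.
apply/measurable_EFinP; apply: (@measurableT_comp _ _ _ _ _ _ (@powR R ^~ r)) => //.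
exact: measurable_tube_sum.
Qed.

Lemma integral_untilt d K k a r Om I g : 0 < K ->
  (\int[lebesgue_point]_y (tube_sum d Om I g y `^ r)%:E =
  (K ^- m)%:E * \int[lebesgue_point]_y
   (tube_sum (K * d)%R [seq K *: w - k | w <- Om] [seq K *: i - a | i <- I]
    (fun w i => g (K^-1 *: (w + k)) (K^-1 *: (i + a))) y `^ r)%:E)%E.
Proof.
move=> K0; under eq_integral do rewrite (tube_sum_untilt _ k a _ _ _ _ K0).
apply: (integral_shear K0 (measurable_untilt K k a)
  (h := fun y => (tube_sum _ _ _ _ y `^ r)%:E)) => [|y].
  exact: measurable_tube_sum_powR.
by rewrite lee_fin powR_ge0.
Qed.

Lemma mass_untilt d K k a s Om I g : 0 < K ->
  mass (K * d) s [seq K *: w - k | w <- Om] [seq K *: i - a | i <- I]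
    (fun w i => g (K^-1 *: (w + k)) (K^-1 *: (i + a))) = K ^+ m * mass d s Om I g.
Proof.
move=> K0; rewrite /mass exprMn -mulrA big_map; do 2 congr (_ * _).
apply: eq_bigr => w _; rewrite big_map; congr (_ `^ _); apply: eq_bigr => i _.
by rewrite !subrK !scalerA mulVf ?gt_eqF// !scale1r.
Qed.

Lemma separated_untilt d K k Om : 0 < K -> delta_separated d Om ->
  delta_separated (K * d) [seq K *: w - k | w <- Om].
Proof.
move=> K0 [uOm sOm]; have injK : injective (fun w : vec => K *: w - k).
  by move=> v w /addIr /scalerI; apply; rewrite gt_eqF.
split; first by rewrite map_inj_uniq.
move=> _ _ /mapP[v vO ->] /mapP[w wO ->] /eqP vw.
rewrite opprB addrA subrK -scalerBr enormZ ?(ltW K0)// ler_pM2l//.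
by apply: sOm => //; apply/eqP => vw'; apply: vw; rewrite vw'.
Qed.

End tubes.

(** * Sums with few terms and integrals of finite sums *)

Section few_terms.
Context {R : realType} {T : eqType}.
Implicit Types (s : seq T) (u : T -> R) (r : R).

Lemma seq_argmax s u : s != [::] ->
  exists2 c, c \in s & forall x, x \in s -> u x <= u c.
Proof.
elim: s => // a s IH _; have [->|/IH[c cs cmax]] := eqVneq s [::].
  by exists a; [exact: mem_head|move=> x; rewrite inE => /eqP->].
have [ac|/ltW ca] := leP (u a) (u c).
  by exists c => [|x]; rewrite inE ?cs ?orbT// => /predU1P[->//|/cmax].
exists a => [|x]; rewrite inE ?eqxx// => /predU1P[->//|/cmax].
by move=> /le_trans; exact.
Qed.

(** The sum is at most [M] times its largest term. *)
Lemma powR_sum_few s u r (M : nat) : 0 < r -> (forall c, 0 <= u c) ->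
  (size [seq c <- s | u c != 0%R] <= M)%N ->
  (\sum_(c <- s) u c) `^ r <= M%:R `^ r * \sum_(c <- s) u c `^ r.
Proof.
move=> r0 u0 sM.
have -> : \sum_(c <- s) u c = \sum_(c <- [seq c <- s | u c != 0]) u c.
  by rewrite big_filter [RHS]big_mkcond; apply: eq_bigr => c _; case: eqP.
have [->|/(seq_argmax u)[c cs cmax]] := eqVneq [seq c <- s | u c != 0] [::].
  rewrite big_nil powR0 ?gt_eqF// mulr_ge0 ?powR_ge0// sumr_ge0// => c _.
  exact: powR_ge0.
have {}cs : c \in s by move: cs; rewrite mem_filter => /andP[].
apply: (@le_trans _ _ ((M%:R * u c) `^ r)).
  rewrite ge0_ler_powR ?nnegrE ?(ltW r0) ?mulr_ge0 ?sumr_ge0//.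
  apply: (le_trans (sum_le_size cmax)); rewrite ler_wpM2r// ler_nat.
  exact: sM.
rewrite powRM// ler_wpM2l ?powR_ge0// (big_rem c)//= lerDl sumr_ge0// => i _.
exact: powR_ge0.
Qed.

Lemma sum_fibers (U : eqType) (V : nmodType) s (f : T -> U) (h : T -> V) :
  \sum_(x <- s) h x =
  \sum_(c <- undup (map f s)) \sum_(x <- [seq x <- s | f x == c]) h x.
Proof.
under [RHS]eq_bigr do rewrite big_filter big_mkcond.
rewrite exchange_big/= big_seq [RHS]big_seq; apply: eq_bigr => x xs.
rewrite (bigD1_seq (f x)) ?undup_uniq ?mem_undup ?map_f//= eqxx big1 ?addr0//.
by move=> c /negPf; rewrite eq_sym => ->.
Qed.

End few_terms.

Section integral_bounds.
Context d (T : measurableType d) (R : realType) (mu : {measure set T -> \bar R}).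
Local Open Scope ereal_scope.

Lemma integral_le_sum (I : eqType) (cs : seq I) (F : T -> R) (G : I -> T -> R)
    (B : I -> R) :
  measurable_fun setT F -> (forall c, measurable_fun setT (G c)) ->
  (forall y, (0 <= F y)%R) -> (forall c y, (0 <= G c y)%R) ->
  (forall y, (F y <= \sum_(c <- cs) G c y)%R) ->
  (forall c, c \in cs -> \int[mu]_y (G c y)%:E <= (B c)%:E) ->
  \int[mu]_y (F y)%:E <= (\sum_(c <- cs) B c)%:E.
Proof.
move=> mF mG F0 G0 FG GB.
apply: (@le_trans _ _ (\int[mu]_y (\sum_(c <- cs) (G c y)%:E))).
  apply: ge0_le_integral => //.
  - by move=> y _; rewrite lee_fin.
  - exact/measurable_EFinP.
  - by apply: emeasurable_sum => c; exact/measurable_EFinP.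
  - by move=> y _; rewrite sumEFin lee_fin.
rewrite ge0_integral_sum//; last 2 first.
- by move=> c; exact/measurable_EFinP.
- by move=> c y _; rewrite lee_fin.
by rewrite -sumEFin big_seq [leRHS]big_seq; exact: lee_sum.
Qed.

Lemma integral_le_add (F G H : T -> R) (a b : R) :
  measurable_fun setT F -> measurable_fun setT G -> measurable_fun setT H ->
  (forall y, (0 <= F y)%R) -> (forall y, (0 <= G y)%R) ->
  (forall y, (0 <= H y)%R) -> (forall y, (F y <= G y + H y)%R) ->
  \int[mu]_y (G y)%:E <= a%:E -> \int[mu]_y (H y)%:E <= b%:E ->
  \int[mu]_y (F y)%:E <= (a + b)%:E.
Proof.
move=> mF mG mH F0 G0 H0 FGH Ga Hb.
have := @integral_le_sum bool [:: true; false] F (fun c => if c then G else H)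
  (fun c => if c then a else b).
rewrite !big_cons !big_nil addr0; apply => //.
- by case.
- by case.
- by move=> y; rewrite !big_cons big_nil addr0.
- by case.
Qed.

Lemma integral_leZ (F : T -> R) (C B : R) : (0 <= C)%R ->
  measurable_fun setT F -> (forall y, (0 <= F y)%R) ->
  \int[mu]_y (F y)%:E <= B%:E -> \int[mu]_y (C * F y)%:E <= (C * B)%:E.
Proof.
move=> C0 mF F0 FB; under eq_integral do rewrite EFinM.
rewrite ge0_integralZl// ?lee_fin//; last 2 first.
- exact/measurable_EFinP.
- by move=> y _; rewrite lee_fin.
by rewrite EFinM lee_wpmul2l// lee_fin.
Qed.

End integral_bounds.

(** * Localization of the translations and magnification *)

Section mass.
Context {R : realType} {m : nat}.
Local Notation vec := 'rV[R]_m.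
Implicit Types (d r s t : R) (Om I : seq vec) (g : vec -> vec -> R).

Lemma mass_ge0 d s Om I g : 0 <= d -> 0 <= mass d s Om I g.
Proof.
by move=> d0; rewrite mulr_ge0 ?exprn_ge0// sumr_ge0// => w _; exact: powR_ge0.
Qed.

Lemma mass_filter_le d s Om I g (P : pred vec) : 0 <= d ->
  mass d s [seq w <- Om | P w] I g <= mass d s Om I g.
Proof.
move=> d0; rewrite ler_wpM2l ?exprn_ge0// big_filter big_mkcond ler_sum// => w _.
by case: ifP => // _; exact: powR_ge0.
Qed.

(** Here and in [sum_mass_shifts] the exponents at least [1] make the powers
    superadditive; with [t = r / s] this is where [s <= r] enters. *)
Lemma sum_mass_dirs (U : eqType) (f : vec -> U) d s t Om I g : 0 <= d -> 1 <= t ->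
  \sum_(c <- undup (map f Om)) mass d s [seq w <- Om | f w == c] I g `^ t
  <= mass d s Om I g `^ t.
Proof.
move=> d0 t1; apply: (le_trans (sum_powR_le _ _ t1 _)) => [c|]; first exact: mass_ge0.
by rewrite -mulr_sumr -sum_fibers.
Qed.

Lemma sum_mass_shifts (U : eqType) (f : vec -> U) d s t Om I g :
  0 <= d -> 1 <= s -> 1 <= t -> (forall w i, 0 <= g w i) ->
  \sum_(c <- undup (map f I)) mass d s Om [seq i <- I | f i == c] g `^ t
  <= mass d s Om I g `^ t.
Proof.
move=> d0 s1 t1 g0.
apply: (le_trans (sum_powR_le _ _ t1 _)) => [c|]; first exact: mass_ge0.
rewrite ge0_ler_powR ?nnegrE ?mass_ge0 ?sumr_ge0// ?(le_trans ler01)//.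
  by move=> c _; exact: mass_ge0.
rewrite -mulr_sumr ler_wpM2l ?exprn_ge0// exchange_big ler_sum// => w _.
rewrite [in leRHS](sum_fibers I f); apply: sum_powR_le => // c.
by rewrite sumr_ge0.
Qed.

End mass.

Section localization.
Context {R : realType} {m : nat}.
Local Notation mR := (measurableTypeR R).
Local Notation vec := 'rV[R]_m.
Local Notation point := (m.-tuple mR * mR)%type.
Implicit Types (d r s K A : R) (Om I : seq vec) (g : vec -> vec -> R) (y : point).

Definition half_cube (v : vec) := forall j, `|v 0 j| <= 2^-1.

Lemma cell_mul K (v : vec) j : 0 <= K * v 0 j - (cell K v 0 j)%:~R < 1.
Proof.
rewrite mxE; have /andP[h1 h2] := floor_itv (K * v 0 j).
by rewrite intrD in h2; apply/andP; split; lra.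
Qed.

(** Tubes with directions in the cube stay within distance [2] of their
    translation, so at most [11 ^ m] of the grid cells of translations
    contribute at a given point. *)
Lemma dual_estimate_localize d r s A : 0 < d <= 1 -> 0 < r -> 1 <= s <= r ->
  0 <= A -> dual_estimate half_cube d r s A ->
  dual_estimate (fun _ : vec => True) d r s ((11 ^ m)%:R `^ r * A).
Proof.
move=> /andP[d0 d1] r0 /andP[s1 sr] A0 est Om I g sepOm OmQ _ g0.
have s0 : 0 < s by apply: lt_le_trans s1.
have d0' := ltW d0.
pose cs := undup (map (cell 2) I).
pose Ic (c : 'rV[int]_m) := [seq i <- I | cell 2 i == c].
pose F c y := tube_sum d Om (Ic c) g y.
have F0 c y : 0 <= F c y by exact: tube_sum_ge0.
have FE y : tube_sum d Om I g y = \sum_(c <- cs) F c y.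
  rewrite /F /tube_sum [RHS]exchange_big/=; apply: eq_bigr => w _.
  exact: sum_fibers.
have few y : (size [seq c <- cs | F c y != 0%R] <= 11 ^ m)%N.
  (* if the tube [(w, i)] meets [y], then [2 * i] is within [4] of [2 * y.1] in
     each coordinate, and [cell 2 i] is less than [1] below [2 * i] *)
  apply: (@size_int_box _ _ (\row_j Num.floor (2 * (tnth y.1 j : R) - 5))).
    by rewrite filter_uniq// undup_uniq.
  move=> c; rewrite mem_filter => /andP[/tube_sum_neq0[w [i [wOm + ty]]] _] j.
  rewrite mem_filter => /andP[/eqP <- _].
  have /andP[y1 y2] : -1 <= (y.2 : R) <= 1 by case: ty => + _; rewrite ler_norml.
  have /andP[w1 w2] := OmQ _ wOm j.
  have /andP[q1 q2] : -1 <= (y.2 : R) * w 0 j <= 1.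
    rewrite -ler_norml normrM -[leRHS]mulr1 ler_pM// ler_norml; lra.
  have := tube_coord j ty; rewrite ler_norml => /andP[t1 t2].
  rewrite !mxE; have /andP[f1 f2] := floor_itv (2 * i 0 j).
  have /andP[e1 e2] := floor_itv (2 * (tnth y.1 j : R) - 5).
  rewrite intrD in f2; rewrite intrD in e2.
  apply/andP; split; first by rewrite le_floor//; lra.
  by rewrite -ltzD1 -(ltr_int R) !intrD; lra.
apply: (@le_trans _ _ (\sum_(c <- cs) ((11 ^ m)%:R `^ r *
    (A * mass d s Om (Ic c) g `^ (r / s))))%:E); last first.
  rewrite lee_fin -mulr_sumr -mulrA ler_wpM2l ?powR_ge0// -mulr_sumr ler_wpM2l//.
  by apply: sum_mass_shifts => //; rewrite ler_pdivlMr// mul1r.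
apply: (@integral_le_sum _ _ _ _ _ _ _ (fun c y => (11 ^ m)%:R `^ r * F c y `^ r)).
- by apply/measurable_EFinP; exact: measurable_tube_sum_powR.
- move=> c; apply: measurable_funM => //.
  by apply/measurable_EFinP; exact: measurable_tube_sum_powR.
- by move=> y; exact: powR_ge0.
- by move=> c y; rewrite mulr_ge0 ?powR_ge0.
- by move=> y; rewrite FE -mulr_sumr; exact: powR_sum_few.
move=> c _; apply: integral_leZ => //.
- by apply/measurable_EFinP; exact: measurable_tube_sum_powR.
- by move=> y; exact: powR_ge0.
pose a : vec := \row_j (2^-1 * (c 0 j)%:~R).
have e1 : (1 ^- m)%:E = 1%E :> \bar R by rewrite expr1n invr1.
rewrite /F (integral_untilt d 0 a r Om _ g ltr01) e1 mul1e.
have {}est : dual_estimate half_cube (1 * d) r s A by rewrite mul1r.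
have := mass_untilt d 0 a s Om (Ic c) g (@ltr01 R).
rewrite expr1n [1 * mass _ _ _ _ _]mul1r => <-; apply: est => //.
- exact: separated_untilt.
- by move=> _ /mapP[w wOm ->]; rewrite scale1r subr0; exact: OmQ.
- move=> _ /mapP[i iI ->] j; move: iI; rewrite mem_filter => /andP[/eqP ci _].
  have := cell_mul 2 i j; rewrite ci !mxE mul1r ler_norml => /andP[h1 h2].
  by apply/andP; split; lra.
Qed.

(** Untilting moves the directions of one cell of side [K^-1] into the unit
    cube; the Jacobian costs [K ^- m], and the normalized counting measure of
    the directions at scale [K * d] gains [K ^+ m]. *)
Lemma integral_cell_le d r s K A Om I g (k : 'rV[int]_m) : 0 < K -> 0 < d ->
  dual_estimate (fun _ : vec => True) (K * d) r s A ->
  delta_separated d Om -> (forall w, w \in Om -> cell K w = k) ->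
  (forall w i, 0 <= g w i) ->
  (\int[lebesgue_point]_y (tube_sum d Om I g y `^ r)%:E <=
   (K ^- m * (A * (K ^+ m * mass d s Om I g) `^ (r / s)))%:E)%E.
Proof.
move=> K0 d0 est sepOm cOm g0; pose kR : vec := \row_j (k 0 j)%:~R.
rewrite (integral_untilt d kR 0 r Om I g K0) EFinM lee_wpmul2l//.
  by rewrite lee_fin invr_ge0 exprn_ge0// ltW.
rewrite -(mass_untilt d kR 0 s Om I g K0); apply: est => //.
  exact: separated_untilt.
move=> _ /mapP[w wOm ->] j.
have := cell_mul K w j; rewrite (cOm _ wOm) !mxE => /andP[h1 h2].
by apply/andP; split; lra.
Qed.

End localization.

(** * Near and far directions *)

Section dichotomy.
Context {R : realType} {m : nat}.
Implicit Types (k : 'rV[int]_m) (s : seq 'rV[int]_m) (r : R).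

Definition far k k' := [exists j, 1 < `|k 0 j - k' 0 j|].

Definition far_pairs s := [seq p <- allpairs pair s s | far p.1 p.2].

Lemma size_near s k : uniq s -> (size [seq x <- s | ~~ far x k] <= 3 ^ m)%N.
Proof.
move=> us; apply: (@size_int_box _ _ (\row_j (k 0 j - 1))).
  exact: filter_uniq.
move=> x; rewrite mem_filter => /andP[+ _] j.
rewrite negb_exists => /forallP/(_ j); rewrite -leNgt ler_norml !mxE => /andP[h1 h2].
move: (x 0 j) (k 0 j) h1 h2 => a b h1 h2.
by apply/andP; split; lia.
Qed.

(** Compare all the terms to the largest one, [u c]. Either the few terms near
    [c] carry half of the sum, or the far ones do; in that case some far term
    [u x] is at least a fixed fraction of the sum, hence so is the geometric
    mean of [u x] and [u c]. *)
Lemma powR_sum_dichotomy s (u : 'rV[int]_m -> R) r : uniq s -> 0 < r ->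
  (forall k, 0 <= u k) ->
  (\sum_(k <- s) u k) `^ r <=
  (2 * 3 ^+ m) `^ r * \sum_(k <- s) u k `^ r +
  (2 * (size s)%:R) `^ r * \sum_(p <- far_pairs s) (u p.1 * u p.2) `^ (r / 2).
Proof.
move=> us r0 u0; set S := \sum_(k <- s) u k.
have S0 : 0 <= S by exact: sumr_ge0.
have A0 : 0 <= \sum_(k <- s) u k `^ r by apply: sumr_ge0 => k _; exact: powR_ge0.
have B0 : 0 <= \sum_(p <- far_pairs s) (u p.1 * u p.2) `^ (r / 2).
  by apply: sumr_ge0 => k _; exact: powR_ge0.
have [s0|/(seq_argmax u)[c cs cmax]] := eqVneq s [::].
  by rewrite /S s0 big_nil powR0 ?gt_eqF// addr_ge0 ?mulr_ge0 ?powR_ge0// -s0.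
have [Sc|Sc] := leP S (2 * 3 ^+ m * u c).
  rewrite -[leLHS]addr0 lerD ?mulr_ge0 ?powR_ge0//.
  apply: (@le_trans _ _ ((2 * 3 ^+ m * u c) `^ r)).
    by rewrite ge0_ler_powR ?nnegrE ?(ltW r0) ?mulr_ge0 ?exprn_ge0.
  rewrite powRM ?mulr_ge0 ?exprn_ge0// ler_wpM2l ?powR_ge0//.
  rewrite (big_rem c)//= lerDl sumr_ge0// => k _; exact: powR_ge0.
pose nears := \sum_(k <- [seq x <- s | ~~ far x c]) u k.
pose fars := \sum_(k <- [seq x <- s | far x c]) u k.
have SE : S = fars + nears by rewrite /S /fars /nears !big_filter (bigID (far^~ c)).
have nearsle : nears <= 3 ^+ m * u c.
  apply: (@le_trans _ _ ((size [seq x <- s | ~~ far x c])%:R * u c)).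
    by apply: sum_le_size => x; rewrite mem_filter => /andP[_]; exact: cmax.
  by rewrite ler_wpM2r// -natrX ler_nat size_near.
have uc0 : 0 <= 3 ^+ m * u c by rewrite mulr_ge0 ?exprn_ge0.
have farsge : S <= 2 * fars by lra.
have [far0|/(seq_argmax u)[x xfar xmax]] := eqVneq [seq x <- s | far x c] [::].
  by move: farsge; rewrite /fars far0 big_nil; lra.
move: (xfar); rewrite mem_filter => /andP[fxc xs].
have Sx : S <= 2 * (size s)%:R * u x.
  apply: (le_trans farsge); rewrite -mulrA ler_pM2l//.
  apply: (le_trans (sum_le_size xmax)); rewrite ler_wpM2r// ler_nat.
  by rewrite size_filter count_size.
rewrite -[leLHS]add0r lerD ?mulr_ge0 ?powR_ge0//.
apply: (@le_trans _ _ ((2 * (size s)%:R * u x) `^ r)).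
  by rewrite ge0_ler_powR ?nnegrE ?(ltW r0) ?mulr_ge0.
rewrite powRM ?mulr_ge0// ler_wpM2l ?powR_ge0//.
have xc : (x, c) \in far_pairs s.
  by rewrite mem_filter fxc/=; apply/allpairsP; exists (x, c).
apply: (@le_trans _ _ ((u x * u c) `^ (r / 2))).
  rewrite -powR_sqr_half//.
  rewrite ge0_ler_powR ?nnegrE ?mulr_ge0 ?divr_ge0 ?(ltW r0)//.
  by rewrite ler_wpM2l// cmax.
rewrite (big_rem _ xc)/= lerDl sumr_ge0// => p _; exact: powR_ge0.
Qed.

(** Integers at distance more than [1] are at distance at least [2], and each
    coordinate [K * w 0 j] is within [1] of the index of its cell. *)
Lemma far_cells (K : R) (w w' : 'rV[R]_m) : 0 < K ->
  far (cell K w) (cell K w') -> K^-1 <= enorm (w - w').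
Proof.
move=> K0 /existsP[j]; rewrite -lez1D -(ler_int R) intr_norm intrB.
have /andP[a1 a2] := cell_mul K w j; have /andP[b1 b2] := cell_mul K w' j.
move: a1 a2 b1 b2.
set a := (cell K w 0 j)%:~R; set b := (cell K w' 0 j)%:~R => a1 a2 b1 b2 ab.
rewrite (le_trans _ (coord_le_enorm _ j))// -[K^-1]mul1r ler_pdivrMr//.
rewrite -[in leRHS](gtr0_norm K0) -normrM !mxE ler_normr.
have {}ab : 2 <= `|a - b| by apply: le_trans ab; rewrite intrD; lra.
by move: ab; rewrite ler_normr => /orP[?|?]; apply/orP; [left|right]; lra.
Qed.

End dichotomy.

(** * Moving weights onto a net *)

Section net_replacement.
Context {R : realType} {m : nat}.
Local Notation mR := (measurableTypeR R).
Local Notation vec := 'rV[R]_m.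
Local Notation point := (m.-tuple mR * mR)%type.
Implicit Types (d r s K A B : R) (Om I : seq vec) (E : {fset vec})
  (g : vec -> vec -> R) (y : point).

(** The bilinear estimate at one scale and one separation, raised to the power
    [r / 2]. *)
Definition bilinear_estimate d c r s B : Prop :=
  forall E E1 E2 : {fset vec}, delta_net d E ->
  (E1 `<=` E)%fset -> (E2 `<=` E)%fset -> sep_by c E1 E2 ->
  forall f g : vec -> vec -> R,
  (forall w i, 0 <= f w i) -> (forall w i, 0 <= g w i) ->
  supported_on E1 f -> supported_on E2 g ->
  (\int[lebesgue_point]_y
     ((tube_sum d E E f y * tube_sum d E E g y) `^ (r / 2))%:E <=
   (B * (mass d s E E f * mass d s E E g) `^ (r / s / 2))%:E)%E.

Definition close d (i i' : vec) := [forall j, `|i 0 j - i' 0 j| <= 2 * d].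

(** The weight of each translation in [I] is given to all the points of the net
    close to it. *)
Definition to_net d Om I g (w i' : vec) : R :=
  if w \in Om then \sum_(i <- I | close d i i') g w i else 0.

Lemma sum_subseq (Om s : seq vec) (h : vec -> R) : uniq Om -> uniq s ->
  {subset Om <= s} ->
  \sum_(w <- Om) h w = \sum_(w <- s) (if w \in Om then h w else 0).
Proof.
move=> uOm us Oms; rewrite -big_mkcond -big_filter; apply: perm_big.
apply: uniq_perm => // [|w]; first exact: filter_uniq.
by rewrite mem_filter; case: (boolP (w \in Om)) => // /Oms ->.
Qed.

(** Slide the point [y] of the tube back to height [0] along [w]: the result
    [u] is within [d] of [i], hence still in the cube, and by maximality it is
    within [d] of some point of the net. *)
Lemma tube_le_net d E w i y : 0 < d <= 2^-1 -> delta_net d E -> half_cube i ->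
  \1_(tube d w i) y <= \sum_(i' <- E | close d i i') \1_(tube d w i') y :> R.
Proof.
move=> /andP[d0 d2] netE ih; rewrite indicE.
have [|_] := boolP (y \in _); last by rewrite sumr_ge0.
rewrite inE => ty; pose u : vec := row_of_tuple y.1 - (y.2 : R) *: w.
have uj j : `|u 0 j - i 0 j| <= d by have := tube_coord j ty; rewrite !mxE.
have uQ : in_cube u.
  move=> j; have := uj j; have := ih j; rewrite !ler_norml.
  by move=> /andP[? ?] /andP[? ?]; apply/andP; split; lra.
have [i' i'E ui'] := delta_net_near (ltW d0) netE uQ.
have ii' : close d i i'.
  apply/forallP => j; have := uj j; have := coord_le_enorm (u - i') j.
  move=> /le_trans/(_ ui'); rewrite !mxE !ler_norml.
  by move=> /andP[? ?] /andP[? ?]; apply/andP; split; lra.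
rewrite (big_rem i')//= ii' indicE mem_set ?lerDl ?sumr_ge0//.
by case: ty.
Qed.

Lemma tube_sum_le_net d E Om I g y : 0 < d <= 2^-1 -> delta_net d E ->
  uniq Om -> {subset Om <= E} -> (forall i, i \in I -> half_cube i) ->
  (forall w i, 0 <= g w i) ->
  tube_sum d Om I g y <= tube_sum d E E (to_net d Om I g) y.
Proof.
move=> d2 netE uOm OmE Ih g0; rewrite /tube_sum (sum_subseq _ uOm (fset_uniq E) OmE).
apply: ler_sum => w _; rewrite /to_net; case: ifPn => wOm; last first.
  by rewrite big1// => i _; rewrite mul0r.
apply: (@le_trans _ _ (\sum_(i <- I) g w i * \sum_(i' <- E | close d i i') \1_(tube d w i') y)).
  rewrite big_seq [leRHS]big_seq ler_sum// => i iI; rewrite ler_wpM2l//.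
  by apply: tube_le_net => //; exact: Ih.
under eq_bigr do rewrite mulr_sumr big_mkcond.
under [leRHS]eq_bigr do rewrite mulr_suml big_mkcond.
by rewrite exchange_big.
Qed.

Lemma size_close d E i : 0 < d -> delta_net d E ->
  (size [seq i' <- E | close d i i'] <= (4 * m + 6) ^ m)%N.
Proof.
move=> d0 netE; rewrite (_ : 4 * m + 6 = (2 * m.+1 * 2).+2)%N; last by lia.
apply: (@separated_size_le _ _ d _ i) => //.
  have [uE sE] := delta_net_separated netE.
  split; first exact: filter_uniq.
  by move=> v w; rewrite !mem_filter => /andP[_ vE] /andP[_ wE]; exact: sE.
move=> v; rewrite mem_filter => /andP[/forallP + _] j => /(_ j).
by rewrite distrC.
Qed.

(** Each translation is counted at most [(4 * m + 6) ^ m] times, the number of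
    points of a net that are close to it. *)
Lemma mass_to_net d s E Om I g : 0 < d -> delta_net d E -> 0 < s ->
  uniq Om -> {subset Om <= E} -> (forall w i, 0 <= g w i) ->
  mass d s E E (to_net d Om I g) <= ((4 * m + 6) ^ m)%:R `^ s * mass d s Om I g.
Proof.
move=> d0 netE s0 uOm OmE g0; rewrite /mass mulrCA ler_wpM2l ?exprn_ge0 ?(ltW d0)//.
rewrite (sum_subseq _ uOm (fset_uniq E) OmE) mulr_sumr ler_sum// => w _.
rewrite /to_net; case: ifPn => wOm; last first.
  by rewrite mulr0 big1// powR0 ?gt_eqF.
rewrite -powRM ?sumr_ge0// ge0_ler_powR ?nnegrE ?(ltW s0) ?mulr_ge0 ?sumr_ge0//.
  by move=> i _; rewrite sumr_ge0.
under eq_bigr do rewrite big_mkcond.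
rewrite exchange_big/= mulr_sumr ler_sum// => i _.
rewrite -big_mkcond/= -big_filter big_const_seq count_predT iter_addr_0.
by rewrite -[leLHS]mulr_natl ler_wpM2r// ler_nat size_close.
Qed.

Lemma bilinear_far_pair d c r s B Om Om1 Om2 I g : 0 < d <= 2^-1 ->
  0 < r -> 0 < s -> 0 <= B -> bilinear_estimate d c r s B ->
  delta_separated d Om -> (forall w, w \in Om -> in_cube w) ->
  (forall i, i \in I -> half_cube i) -> (forall w i, 0 <= g w i) ->
  (forall w w', w \in Om1 -> w' \in Om2 -> c <= enorm (w - w')) ->
  subseq Om1 Om -> subseq Om2 Om ->
  (\int[lebesgue_point]_y
     ((tube_sum d Om1 I g y * tube_sum d Om2 I g y) `^ (r / 2))%:E <=
   (B * (((4 * m + 6) ^ m)%:R `^ s * mass d s Om I g) `^ (r / s))%:E)%E.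
Proof.
move=> d2 r0 s0 B0 bil sepOm OmQ Ih g0 sep12 sub1 sub2.
have /andP[d0 d21] := d2.
have d1 : 0 < d <= 1 by apply/andP; split; lra.
have [E netE OmE] := delta_net_extend d1 sepOm OmQ.
have [uOm _] := sepOm.
have [u1 u2] := (subseq_uniq sub1 uOm, subseq_uniq sub2 uOm).
have Om1E : {subset Om1 <= E} by move=> w /(mem_subseq sub1) /OmE.
have Om2E : {subset Om2 <= E} by move=> w /(mem_subseq sub2) /OmE.
have f0 Om' w i : 0 <= to_net d Om' I g w i.
  by rewrite /to_net; case: ifP => // _; rewrite sumr_ge0.
have supp Om' : supported_on [fset w in Om']%fset (to_net d Om' I g).
  by move=> w i; rewrite inE /to_net => /negbTE ->.
have E1E : ([fset w in Om1] `<=` E)%fset.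
  by apply/fsubsetP => w; rewrite inE; exact: Om1E.
have E2E : ([fset w in Om2] `<=` E)%fset.
  by apply/fsubsetP => w; rewrite inE; exact: Om2E.
have sepE : sep_by c [fset w in Om1]%fset [fset w in Om2]%fset.
  by move=> w w'; rewrite !inE; exact: sep12.
have bound := bil E _ _ netE E1E E2E sepE _ _ (f0 Om1) (f0 Om2) (supp Om1) (supp Om2).
have mF g1 g2 Om' Om'' I' I'' : measurable_fun setT
    (fun y => ((tube_sum d Om' I' g1 y * tube_sum d Om'' I'' g2 y) `^ (r / 2))%:E).
  apply/measurable_EFinP; apply: (@measurableT_comp _ _ _ _ _ _ (@powR R ^~ _)) => //.
  by apply: measurable_funM; exact: measurable_tube_sum.
refine (le_trans _ (le_trans bound _)).
  apply: ge0_le_integral => //.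
  - by move=> y _; rewrite lee_fin powR_ge0.
  - move=> y _; rewrite lee_fin ge0_ler_powR ?nnegrE ?divr_ge0 ?(ltW r0)//;
      rewrite ?mulr_ge0 ?tube_sum_ge0//.
    by rewrite ler_pM ?tube_sum_ge0 ?tube_sum_le_net.
rewrite lee_fin; apply: (ler_wpM2l B0); set P := ((4 * m + 6) ^ m)%:R `^ s.
have P0 : 0 <= P by exact: powR_ge0.
have M0 := @mass_ge0 R m d s Om I g (ltW d0).
have le_mass Om' : subseq Om' Om -> uniq Om' -> {subset Om' <= E} ->
    mass d s E E (to_net d Om' I g) <= P * mass d s Om I g.
  move=> sub u OE; apply: (le_trans (mass_to_net _ _ _ _ _ _ _)) => //.
  rewrite ler_wpM2l// (subseq_uniqP uOm sub).
  exact: mass_filter_le (ltW d0).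
rewrite -[leRHS]powR_sqr_half; last by apply: mulr_ge0 P0 M0.
rewrite ge0_ler_powR ?nnegrE ?divr_ge0 ?(ltW r0) ?(ltW s0)//.
- by apply: mulr_ge0; apply: mass_ge0; exact: ltW.
- by apply: mulr_ge0; apply: mulr_ge0 P0 M0.
by apply: ler_pM; [apply: mass_ge0; exact: ltW|apply: mass_ge0; exact: ltW|
  exact: le_mass|exact: le_mass].
Qed.

End net_replacement.

(** * Induction on scales *)

Section induction_on_scales.
Context {R : realType} {m : nat}.
Local Notation mR := (measurableTypeR R).
Local Notation vec := 'rV[R]_m.
Local Notation point := (m.-tuple mR * mR)%type.
Implicit Types (d r s A B : R) (K : nat) (Om I : seq vec)
  (g : vec -> vec -> R) (y : point).

Lemma size_cells K Om : (forall w, w \in Om -> in_cube w) ->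
  (size (undup (map (cell K%:R) Om)) <= (2 * K).+1 ^ m)%N.
Proof.
move=> OmQ; apply: (@size_int_box _ _ (\row_j - K%:Z)); first exact: undup_uniq.
move=> k; rewrite mem_undup => /mapP[w wOm ->] j; rewrite !mxE.
have /andP[w1 w2] := OmQ _ wOm j.
have K0 : 0 <= K%:R :> R by [].
rewrite floor_ge_int -ltzD1 floor_lt_int intrN -!pmulrn; apply/andP; split.
  by rewrite -[leLHS]mulrN1 ler_wpM2l.
rewrite !intrD intrN -!pmulrn natrM.
have : K%:R * w 0 j <= K%:R * 1 by rewrite ler_wpM2l.
by lra.
Qed.

(** One step of the induction on scales.  The constant in front of [A] involves
    [K] only through the powers coming from the magnification; the dependence on
    [K] of the bilinear term is harmless. *)
Lemma dual_estimate_step d K r s A B : (0 < K)%N -> 0 < d <= 2^-1 -> 0 < r ->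
  1 <= s <= r -> 0 <= A -> 0 <= B ->
  dual_estimate (fun _ : vec => True) (K%:R * d) r s A ->
  @bilinear_estimate R m d K%:R^-1 r s B ->
  dual_estimate (fun _ : vec => True) d r s
   ((11 ^ m)%:R `^ r *
    ((2 * 3 ^+ m) `^ r * (K%:R ^- m * (A * (K%:R ^+ m) `^ (r / s))) +
     (2 * ((2 * K).+1 ^ m)%:R) `^ r * (((2 * K).+1 ^ m)%:R ^+ 2 *
       (B * (((4 * m + 6) ^ m)%:R `^ s) `^ (r / s))))).
Proof.
move=> K0 d2 r0 s1r A0 B0 est bil; have /andP[s1 sr] := s1r.
have K0R : 0 < K%:R :> R by rewrite ltr0n.
have s0 : 0 < s by apply: lt_le_trans s1.
have /andP[d0 d21] := d2.
set N := ((2 * K).+1 ^ m)%:R; set P := _ `^ s.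
have N0 : 0 <= N by [].
have P0 : 0 <= P by exact: powR_ge0.
have [c1 c2] : 0 <= (2 * 3 ^+ m : R) `^ r /\ 0 <= (2 * N) `^ r by rewrite !powR_ge0.
have A1 : 0 <= K%:R ^- m * (A * (K%:R ^+ m) `^ (r / s)).
  by rewrite mulr_ge0 ?mulr_ge0 ?powR_ge0// invr_ge0 exprn_ge0.
have B1 : 0 <= N ^+ 2 * (B * P `^ (r / s)).
  by rewrite mulr_ge0 ?mulr_ge0 ?powR_ge0// exprn_ge0.
apply: dual_estimate_localize => //.
- by apply/andP; split => //; lra.
- by rewrite addr_ge0// mulr_ge0.
move=> Om I g sepOm OmQ Ih g0.
pose ks := undup (map (cell K%:R) Om).
pose Omk k := [seq w <- Om | cell K%:R w == k].
pose u k y := tube_sum d (Omk k) I g y.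
have u0 k y : 0 <= u k y by exact: tube_sum_ge0.
have ksN : (size ks)%:R <= N by rewrite ler_nat size_cells.
set M := mass d s Om I g.
have M0 : 0 <= M by apply: mass_ge0; exact: ltW.
have mur k : measurable_fun setT (fun y => u k y `^ r).
  by apply/measurable_EFinP; exact: measurable_tube_sum_powR.
have muu k k' : measurable_fun setT (fun y => (u k y * u k' y) `^ (r / 2)).
  apply: (@measurableT_comp _ _ _ _ _ _ (@powR R ^~ _)) => //.
  by apply: measurable_funM; exact: measurable_tube_sum.
rewrite (mulrDl _ _ (M `^ _)) -(mulrA (_ `^ r)) -(mulrA (_ `^ r)).
apply: (@integral_le_add _ _ _ _ _
  (fun y => (2 * 3 ^+ m) `^ r * \sum_(k <- ks) u k y `^ r)
  (fun y => (2 * N) `^ r * \sum_(p <- far_pairs ks) (u p.1 y * u p.2 y) `^ (r / 2))).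
- by apply/measurable_EFinP; exact: measurable_tube_sum_powR.
- by apply: measurable_funM => //; apply: measurable_sum.
- by apply: measurable_funM => //; apply: measurable_sum => p; exact: muu.
- by move=> y; exact: powR_ge0.
- by move=> y; apply: mulr_ge0 => //; apply: sumr_ge0 => k _; exact: powR_ge0.
- by move=> y; apply: mulr_ge0 => //; apply: sumr_ge0 => k _; exact: powR_ge0.
- move=> y; rewrite {1}/tube_sum (sum_fibers _ (cell K%:R)).
  apply: (le_trans (powR_sum_dichotomy (u := u^~ y) (undup_uniq _) r0 _)) => //.
  rewrite lerD2l ler_wpM2r//.
    by apply: sumr_ge0 => k _; exact: powR_ge0.
  by rewrite ge0_ler_powR ?nnegrE ?(ltW r0) ?mulr_ge0// ler_pM2l.
- apply: integral_leZ => //.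
  + by apply: measurable_sum.
  + by move=> y; apply: sumr_ge0 => k _; exact: powR_ge0.
  apply: (@le_trans _ _ (\sum_(k <- ks) K%:R ^- m *
      (A * (K%:R ^+ m * mass d s (Omk k) I g) `^ (r / s)))%:E).
    apply: (@integral_le_sum _ _ _ _ _ _ _ (fun k y => u k y `^ r)) => //.
    + by apply: measurable_sum.
    + by move=> y; apply: sumr_ge0 => k _; exact: powR_ge0.
    + by move=> k y; exact: powR_ge0.
    move=> k _. have := @integral_cell_le R m d r s K%:R A (Omk k) I g k K0R d0 est.
    apply => //.
    * have [uOm sOm] := sepOm; split; first exact: filter_uniq.
      by move=> v w; rewrite !mem_filter => /andP[_ ?] /andP[_ ?]; exact: sOm.
    * by move=> w; rewrite mem_filter => /andP[/eqP].
  rewrite lee_fin -mulr_sumr -[leRHS]mulrA ler_wpM2l ?invr_ge0 ?exprn_ge0//.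
  rewrite -mulr_sumr -[leRHS]mulrA ler_wpM2l//.
  under eq_bigr do rewrite powRM ?exprn_ge0 ?mass_ge0 ?(ltW d0)//.
  rewrite -mulr_sumr ler_wpM2l ?powR_ge0//.
  apply: sum_mass_dirs; first exact: ltW.
  by rewrite ler_pdivlMr// mul1r.
- apply: integral_leZ => //.
  + by apply: measurable_sum => p; exact: muu.
  + by move=> y; apply: sumr_ge0 => k _; exact: powR_ge0.
  apply: (@le_trans _ _ (\sum_(p <- far_pairs ks) (B * (P * M) `^ (r / s)))%:E).
    apply: (@integral_le_sum _ _ _ _ _ _ _
      (fun p y => (u p.1 y * u p.2 y) `^ (r / 2)) (fun=> B * (P * M) `^ (r / s))) => //.
    + by apply: measurable_sum => p; exact: muu.
    + by move=> y; apply: sumr_ge0 => k _; exact: powR_ge0.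
    + by move=> p y; exact: powR_ge0.
    case=> k k'; rewrite mem_filter => /andP[/= kk' _].
    apply: (bilinear_far_pair d2 r0 s0 B0 bil) => //; try exact: filter_subseq.
    move=> w w'; rewrite !mem_filter => /andP[/eqP wk _] /andP[/eqP wk' _].
    by apply: far_cells => //; rewrite wk wk'.
  rewrite lee_fin; have X0 : 0 <= B * (P * M) `^ (r / s) by rewrite mulr_ge0 ?powR_ge0.
  apply: (le_trans (sum_le_size (b := B * (P * M) `^ (r / s)) _)) => [p _ //|].
  apply: (@le_trans _ _ (N ^+ 2 * (B * (P * M) `^ (r / s)))); last first.
    by rewrite (powRM _ P0 M0) !mulrA.
  rewrite ler_wpM2r// /N -natrX ler_nat size_filter (leq_trans (count_size _ _))//.
  rewrite size_allpairs.
  by rewrite leq_mul// -(ler_nat R).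
Qed.

End induction_on_scales.

Section iteration.
Context {R : realType} {m : nat}.
Local Notation mR := (measurableTypeR R).
Local Notation vec := 'rV[R]_m.
Local Notation point := (m.-tuple mR * mR)%type.
Implicit Types (d r s A B L T : R) (w i : vec) (K : nat) (Om I : seq vec)
  (g : vec -> vec -> R) (y : point).

Lemma tube_slab d L w i y : in_cube w -> (forall j, `|i 0 j| <= L) ->
  tube d w i y -> slab m (L + 1 + d) y.
Proof.
move=> wQ iL ty; case: (ty) => y1 _; split => // j.
have /andP[w1 w2] := wQ j; have := tube_coord j ty; have := iL j.
have := y1; rewrite !ler_norml => /andP[a1 a2] /andP[b1 b2] /andP[c1 c2].
have /andP[q1 q2] : -1 <= (y.2 : R) * w 0 j <= 1.
  rewrite -ler_norml normrM -[leRHS]mulr1 ler_pM// ler_norml; lra.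
by apply/andP; split; lra.
Qed.

Lemma integral_tube_sum_le d L r Om I g : 0 < r ->
  (forall w, w \in Om -> in_cube w) ->
  (forall i, i \in I -> forall j, `|i 0 j| <= L) -> (forall w i, 0 <= g w i) ->
  (\int[lebesgue_point]_y (tube_sum d Om I g y `^ r)%:E <=
   ((\sum_(w <- Om) \sum_(i <- I) g w i) `^ r *
    fine (lebesgue_point (slab m (L + 1 + d))))%:E)%E.
Proof.
move=> r0 OmQ IL g0; set S := \sum_(w <- Om) _.
have mS := @measurable_slab R m (L + 1 + d).
have S0 : 0 <= S by do 2 (apply: sumr_ge0 => ? _).
apply: (@le_trans _ _ (\int[lebesgue_point]_y ((S `^ r) * \1_(slab m (L + 1 + d)) y)%:E)%E).
  apply: ge0_le_integral => //.
  - by move=> y _; rewrite lee_fin powR_ge0.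
  - exact: measurable_tube_sum_powR.
  - by apply/measurable_EFinP; apply: measurable_funM => //; exact: measurable_indic.
  - move=> y _; rewrite lee_fin.
    have [->|] := eqVneq (tube_sum d Om I g y) 0.
      by rewrite powR0 ?gt_eqF// mulr_ge0 ?powR_ge0.
    move=> /tube_sum_neq0[w [i [wOm iI ty]]].
    rewrite indicE mem_set ?mulr1; last exact: tube_slab (OmQ _ wOm) (IL _ iI) ty.
    rewrite ge0_ler_powR ?nnegrE ?(ltW r0) ?tube_sum_ge0//.
    exact: tube_sum_le.
under eq_integral do rewrite EFinM.
rewrite ge0_integralZl//; last 2 first.
- by apply/measurable_EFinP; exact: measurable_indic.
- by rewrite lee_fin powR_ge0.
rewrite integral_indic// setIT EFinM fineK//.
by rewrite ge0_fin_numE// lebesgue_slab.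
Qed.

(** At scales bounded below there are boundedly many directions, and every
    tube lies in a fixed bounded region. *)
Lemma dual_estimate_coarse d1 r s : 0 < d1 -> 0 < r -> 1 <= s <= r ->
  exists2 T, 0 <= T & forall d, d1 <= d <= 1 ->
    dual_estimate (fun _ : vec => True) d r s T.
Proof.
move=> d10 r0 s1r; have /andP[s1 sr] := s1r.
have s0 : 0 < s by apply: lt_le_trans s1.
pose V := fine (@lebesgue_point R m (slab m 3)).
have V0 : 0 <= V by rewrite fine_ge0.
pose N := (4 * m + 6)%:R ^+ m / d1 ^+ m : R.
have N0 : 0 <= N by rewrite divr_ge0 ?exprn_ge0 ?ltW.
pose T := (N * (d1 ^- m) `^ s^-1) `^ r * V.
have T0 : 0 <= T by rewrite mulr_ge0 ?powR_ge0.
exists ((11 ^ m)%:R `^ r * T); first by rewrite mulr_ge0 ?powR_ge0.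
move=> d /andP[d1d dle1].
have d0 : 0 < d by apply: lt_le_trans d1d.
apply: dual_estimate_localize => //; first by rewrite d0.
move=> Om I g sepOm OmQ Ih g0; set M := mass d s Om I g.
have M0 : 0 <= M by apply: mass_ge0; exact: ltW.
have D0 : 0 <= d1 ^- m by rewrite invr_ge0 exprn_ge0// ltW.
have step : \sum_(w <- Om) \sum_(i <- I) g w i <= N * (d1 ^- m) `^ s^-1 * M `^ s^-1.
  rewrite -mulrA -powRM ?invr_ge0 ?exprn_ge0 ?(ltW d10)//.
  apply: (@le_trans _ _ ((size Om)%:R * (d1 ^- m * M) `^ s^-1)).
    apply: sum_le_size => w wOm.
    have G0 : 0 <= \sum_(i <- I) g w i by apply: sumr_ge0.
    rewrite -[leLHS]powRr1// -[X in _ `^ X](mulfV (lt0r_neq0 s0)) powRrM.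
    have gs0 : 0 <= \sum_(w <- Om) (\sum_(i <- I) g w i) `^ s.
      by apply: sumr_ge0 => ? _; exact: powR_ge0.
    rewrite ge0_ler_powR ?nnegrE ?invr_ge0 ?(ltW s0) ?powR_ge0//.
      by rewrite mulr_ge0// invr_ge0 exprn_ge0// ltW.
    apply: (@le_trans _ _ (\sum_(w <- Om) (\sum_(i <- I) g w i) `^ s)).
      by rewrite [leRHS](big_rem w)//= lerDl sumr_ge0// => ? _; exact: powR_ge0.
    rewrite /M /mass mulrA ler_peMl// mulrC -expr_div_n exprn_ege1//.
    by rewrite ler_pdivlMr// mul1r.
  rewrite ler_wpM2r ?powR_ge0// ler_pdivlMr ?exprn_gt0//.
  apply: (@le_trans _ _ ((size Om)%:R * d ^+ m)).
    by rewrite ler_wpM2l// lerXn2r// ?nnegrE ltW.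
  by apply: separated_cube_size => //; rewrite d0.
refine (le_trans (@integral_tube_sum_le d (2 - d) r Om I g r0 OmQ _ g0) _).
  by move=> i /Ih ih j; rewrite (le_trans (ih j))//; lra.
rewrite (_ : 2 - d + 1 + d = 3); last by ring.
rewrite lee_fin /T -/V [leRHS]mulrAC ler_wpM2r//.
rewrite -[r / s]mulrC powRrM -powRM ?mulr_ge0 ?powR_ge0//.
rewrite ge0_ler_powR ?nnegrE ?(ltW r0) ?mulr_ge0 ?powR_ge0//.
by do 2 (apply: sumr_ge0 => ? _).
Qed.

Lemma dual_estimate_le (P : vec -> Prop) d r s A B : A <= B ->
  dual_estimate P d r s A -> dual_estimate P d r s B.
Proof.
move=> AB est Om I g sepOm OmQ IP g0; refine (le_trans (est _ _ _ sepOm OmQ IP g0) _).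
by rewrite lee_fin ler_wpM2r ?powR_ge0.
Qed.

(** With the powers of [K] collected, the left side is [C0 * K `^ (- e)] times
    [K `^ (kappa + m * (r / s) - m)] times twice the right side; the hypotheses
    bound the first factor by [2^-1] and the second by [1]. *)
Lemma powR_magnify (K d r s kappa e C C0 : R) : 1 <= K -> 0 < d -> 0 <= C ->
  kappa + m%:R * (r / s) <= m%:R -> C0 * 2 <= K `^ e ->
  C0 * (K ^- m * (C * (K * d) `^ (- e) * (K * d) `^ kappa * (K ^+ m) `^ (r / s)))
    <= C / 2 * d `^ (- e) * d `^ kappa.
Proof.
move=> K1 d0 C0' hk hC; have K0 : 0 < K by apply: lt_le_trans K1.
rewrite !powRM ?(ltW K0) ?(ltW d0)//.
rewrite (_ : C0 * _ = (C0 * K `^ (- e)) * (K ^- m * K `^ kappa * (K ^+ m) `^ (r / s)) *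
  (C * d `^ (- e) * d `^ kappa)); last by ring.
rewrite (_ : C / 2 * _ * _ = (2^-1 * 1) * (C * d `^ (- e) * d `^ kappa)); last by ring.
rewrite ler_wpM2r ?mulr_ge0 ?powR_ge0//.
have h1 : C0 * K `^ (- e) <= 2^-1.
  rewrite powRN ler_pdivrMr ?powR_gt0//; lra.
have h2 : K ^- m * K `^ kappa * (K ^+ m) `^ (r / s) <= 1.
  rewrite -powR_invn ?(ltW K0)// -powR_mulrn ?(ltW K0)// -powRrM -!powRD;
    try by rewrite (lt0r_neq0 K0) implybT.
  by rewrite -[leRHS](powRr0 K) ler_powR//; lra.
have h3 : 0 <= K ^- m * K `^ kappa * (K ^+ m) `^ (r / s).
  by rewrite mulr_ge0 ?mulr_ge0 ?powR_ge0// invr_ge0 exprn_ge0// ltW.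
apply: (@le_trans _ _ (2^-1 * (K ^- m * K `^ kappa * (K ^+ m) `^ (r / s)))).
  by rewrite ler_wpM2r.
by rewrite ler_pM2l.
Qed.

Lemma exists_scale_ratio (e M : R) : 0 < e ->
  exists2 K : nat, (1 < K)%N & M <= K%:R `^ e.
Proof.
move=> e0; pose x := `|M| `^ e^-1; exists (Num.truncn x).+2 => //.
apply: (le_trans (ler_norm M)).
rewrite -[leLHS]powRr1// -[X in _ `^ X](mulVf (lt0r_neq0 e0)) powRrM.
rewrite ge0_ler_powR ?nnegrE ?(ltW e0) ?powR_ge0//.
by rewrite (le_trans (ltW (truncnS_gt _)))// ler_nat.
Qed.

(** If the estimate at scale [K * d] has constant [C * (K * d) `^ (- e)] in
    units of the critical power of the scale, the step from [K * d] to [d]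
    multiplies it by a constant independent of [K] and adds a bilinear term;
    with [K] so large that the gain [K `^ (- e)] beats that constant, the
    form of the bound is reproduced at scale [d]. *)
Lemma dual_estimate_of_bilinear (r s kappa d0 : R) :
  0 < r -> 1 <= s <= r -> 0 < d0 -> kappa + m%:R * (r / s) <= m%:R ->
  (forall c e : R, 0 < c -> 0 < e -> exists2 B, 0 < B & forall d, 0 < d < d0 ->
    @bilinear_estimate R m d c r s (B * d `^ (- e) * d `^ kappa)) ->
  forall e : R, 0 < e -> exists2 C, 0 < C & forall d, 0 < d <= 1 ->
    dual_estimate (fun _ : vec => True) d r s (C * d `^ (- e) * d `^ kappa).
Proof.
move=> r0 s1r d00 hk bil e e0.
pose C0 : R := (11 ^ m)%:R `^ r * (2 * 3 ^+ m) `^ r.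
have [K K1 hK] := exists_scale_ratio (C0 * 2) e0.
have K0 : (0 < K)%N by apply: ltn_trans K1.
have K0R : 0 < K%:R :> R by rewrite ltr0n.
have K2R : 2 <= K%:R :> R by rewrite ler_nat.
have Kinv : 0 < K%:R^-1 :> R by rewrite invr_gt0.
have [B B0 {}bil] := bil K%:R^-1 e Kinv e0.
(* below [d1] the bilinear estimate applies at scale [d], and [K * d <= 1] *)
pose d1 := Num.min d0 K%:R^-1 / 2.
have d10 : 0 < d1 by rewrite divr_gt0// lt_min d00.
have d1d0 : d1 < d0.
  have : Num.min d0 K%:R^-1 <= d0 by rewrite ge_min lexx.
  by rewrite /d1; lra.
have d1K : d1 * 2 <= K%:R^-1.
  by rewrite divfK// ge_min lexx orbT.
have K12 : K%:R^-1 <= 2^-1 :> R by rewrite lef_pV2 ?posrE.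
have [T T0 coarse] := dual_estimate_coarse d10 r0 s1r.
pose Bt := (11 ^ m)%:R `^ r * ((2 * ((2 * K).+1 ^ m)%:R) `^ r *
  (((2 * K).+1 ^ m)%:R ^+ 2 * (B * (((4 * m + 6) ^ m)%:R `^ s) `^ (r / s)))).
have Bt0 : 0 <= Bt by rewrite !mulr_ge0 ?powR_ge0 ?exprn_ge0 ?(ltW B0).
pose C := T / d1 `^ `|kappa| + 2 * Bt + 1.
have T1 : 0 <= T / d1 `^ `|kappa| by rewrite divr_ge0 ?powR_ge0.
have Cpos : 0 < C by rewrite /C; lra.
exists C => //.
have base d : d1 <= d <= 1 ->
    dual_estimate (fun _ : vec => True) d r s (C * d `^ (- e) * d `^ kappa).
  move=> /andP[d1d dle1]; have d0' : 0 < d by apply: lt_le_trans d1d.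
  apply: dual_estimate_le (coarse d _); last by rewrite d1d.
  have hd : d1 `^ `|kappa| <= d `^ kappa.
    apply: (@le_trans _ _ (d `^ `|kappa|)).
      by rewrite ge0_ler_powR ?nnegrE ?(ltW d10) ?(ltW d0').
    by rewrite ger_powR ?ler_norm// d0'.
  have he : 1 <= d `^ (- e).
    by rewrite -(powRr0 d) ger_powR ?d0'// oppr_le0 ltW.
  apply: (@le_trans _ _ (T / d1 `^ `|kappa| * d1 `^ `|kappa|)).
    by rewrite divfK// gt_eqF// powR_gt0.
  rewrite ler_pM ?powR_ge0//.
  apply: (@le_trans _ _ (C * 1)); first by rewrite mulr1 /C; lra.
  by rewrite ler_pM2l.
suff ind j : forall d, d1 * K%:R ^- j <= d <= 1 ->
    dual_estimate (fun _ : vec => True) d r s (C * d `^ (- e) * d `^ kappa).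
  move=> d /andP[d0' dle1].
  pose j := (Num.truncn (d1 / d)).+1; apply: (ind j); rewrite dle1 andbT.
  rewrite ler_pdivrMr ?exprn_gt0// -ler_pdivrMl// mulrC.
  apply: (le_trans (ltW (truncnS_gt _))); rewrite -natrX ler_nat.
  exact/ltnW/ltn_expl.
elim: j => [|j IH] d /andP[djd dle1].
  by apply: base; rewrite -[d1]divr1 -[X in _ / X](expr0 K%:R) djd.
have [d1d|dd1] := leP d1 d; first by apply: base; rewrite d1d.
have d0' : 0 < d.
  by apply: lt_le_trans djd; rewrite mulr_gt0// invr_gt0 exprn_gt0.
have d2 : 0 < d <= 2^-1 by rewrite d0'/=; lra.
have Kd1 : K%:R * d <= 1.
  rewrite mulrC -ler_pdivlMr// mul1r; lra.
have {}IH : dual_estimate (fun _ : vec => True) (K%:R * d) r s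
    (C * (K%:R * d) `^ (- e) * (K%:R * d) `^ kappa).
  apply: IH; rewrite Kd1 andbT ler_pdivrMr ?exprn_gt0//.
  move: djd; rewrite ler_pdivrMr ?exprn_gt0// exprS mulrA.
  by rewrite [d * K%:R]mulrC.
have A0 : 0 <= C * (K%:R * d) `^ (- e) * (K%:R * d) `^ kappa.
  by rewrite !mulr_ge0 ?powR_ge0 ?ltW.
have B0' : 0 <= B * d `^ (- e) * d `^ kappa.
  by rewrite !mulr_ge0 ?powR_ge0 ?ltW.
have dd0 : 0 < d < d0 by rewrite d0' (lt_trans dd1).
apply: dual_estimate_le (dual_estimate_step K0 d2 r0 s1r A0 B0' IH (bil d dd0)).
rewrite mulrDr [X in X + _]mulrA.
have h1 := @powR_magnify K%:R d r s kappa e C C0 _ d0' (ltW Cpos) hk hK.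
apply: (@le_trans _ _ (C / 2 * d `^ (- e) * d `^ kappa + Bt * d `^ (- e) * d `^ kappa)).
  apply: lerD; first by apply: h1; lra.
  by rewrite /Bt le_eqVlt; apply/orP; left; apply/eqP; ring.
rewrite -!mulrDl ler_wpM2r ?powR_ge0// ler_wpM2r ?powR_ge0//.
by rewrite /C; lra.
Qed.

End iteration.

(** * Duality *)

Section discrete_norms.
Context {R : realType}.

(** Young's inequality for [u / X] and [v / Y], in the form that is summed to
    give Hoelder's inequality when [X] and [Y] are the two norms. *)
Lemma young_scaled (u v X Y s q : R) : 0 <= u -> 0 <= v -> 0 < X -> 0 < Y ->
  0 < s -> 0 < q -> s^-1 + q^-1 = 1 ->
  u * v <= X * Y * ((u / X) `^ s / s + (v / Y) `^ q / q).
Proof.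
move=> u0 v0 X0 Y0 s0 q0 sq.
have -> : u * v = X * Y * ((u / X) * (v / Y)) by field; rewrite !gt_eqF.
by rewrite ler_wpM2l ?mulr_ge0 ?(ltW X0) ?(ltW Y0)// conjugate_powR ?divr_ge0 ?(ltW X0) ?(ltW Y0).
Qed.

Lemma sum_hoelder (I : eqType) (x : seq I) (a b : I -> R) (s q : R) :
  (forall i, 0 <= a i) -> (forall i, 0 <= b i) -> 0 < s -> 0 < q ->
  s^-1 + q^-1 = 1 ->
  \sum_(i <- x) a i * b i <=
  (\sum_(i <- x) a i `^ s) `^ s^-1 * (\sum_(i <- x) b i `^ q) `^ q^-1.
Proof.
move=> a0 b0 s0 q0 sq.
have root (c : I -> R) t : (forall i, 0 <= c i) -> 0 < t ->
    (\sum_(i <- x) c i `^ t) `^ t^-1 = 0 -> forall i, i \in x -> c i = 0.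
  move=> c0 t0 /powR_eq0_eq0 sum0 i ix; apply: (@powR_eq0_eq0 _ _ t).
  apply/eqP; rewrite eq_le powR_ge0 andbT -sum0 (big_rem i)//= lerDl.
  by apply: sumr_ge0 => j _; exact: powR_ge0.
set A := _ `^ s^-1; set B := _ `^ q^-1.
have [A0|A0] := eqVneq A 0.
  rewrite big_seq big1 ?mulr_ge0 ?powR_ge0// => i ix.
  by rewrite (root a s)// mul0r.
have [B0|B0] := eqVneq B 0.
  rewrite big_seq big1 ?mulr_ge0 ?powR_ge0// => i ix.
  by rewrite [b i](root b q)// mulr0.
have Ap : 0 < A by rewrite lt0r A0 powR_ge0.
have Bp : 0 < B by rewrite lt0r B0 powR_ge0.
have norm1 (c : I -> R) t : (forall i, 0 <= c i) -> 0 < t ->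
    0 < (\sum_(i <- x) c i `^ t) `^ t^-1 ->
    \sum_(i <- x) (c i / (\sum_(i <- x) c i `^ t) `^ t^-1) `^ t = 1.
  move=> c0 t0 Cp; set C := (\sum_(i <- x) c i `^ t) `^ t^-1.
  under eq_bigr do rewrite powRM ?invr_ge0 ?powR_ge0//.
  rewrite -mulr_suml.
  have S0 : 0 <= \sum_(i <- x) c i `^ t by apply: sumr_ge0 => ? _; exact: powR_ge0.
  have -> : \sum_(i <- x) c i `^ t = C `^ t.
    by rewrite /C -powRrM mulVf ?gt_eqF// powRr1.
  by rewrite -powRM ?invr_ge0 ?powR_ge0// mulfV ?gt_eqF// powR1.
have nA : \sum_(i <- x) (a i / A) `^ s = 1 := norm1 a s a0 s0 Ap.
have nB : \sum_(i <- x) (b i / B) `^ q = 1 := norm1 b q b0 q0 Bp.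
move: A B {A0 B0} Ap Bp nA nB => A B Ap Bp nA nB.
apply: (@le_trans _ _ (\sum_(i <- x) A * B * ((a i / A) `^ s / s + (b i / B) `^ q / q))).
  by apply: ler_sum => i _; exact: young_scaled.
by rewrite -mulr_sumr big_split/= -!mulr_suml nA nB !mul1r sq mulr1.
Qed.

Local Open Scope ereal_scope.

Lemma bigmaxe_le (I : eqType) (x : seq I) (h : I -> \bar R) c : 0 <= c ->
  (forall i, i \in x -> h i <= c) -> \big[maxe/0]_(i <- x) h i <= c.
Proof.
move=> c0; elim: x => [|i x IH] hc; first by rewrite big_nil.
rewrite big_cons ge_max hc ?mem_head//= IH// => j jx.
by rewrite hc// in_cons jx orbT.
Qed.

Lemma le_bigmaxe (I : eqType) (x : seq I) (h : I -> \bar R) i :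
  i \in x -> h i <= \big[maxe/0]_(j <- x) h j.
Proof.
elim: x => // j x IH; rewrite in_cons big_cons le_max => /predU1P[->|/IH ->].
  by rewrite lexx.
by rewrite orbT.
Qed.

Lemma bigmaxe_ge0 (I : Type) (x : seq I) (h : I -> \bar R) :
  0 <= \big[maxe/0]_(j <- x) h j.
Proof.
by elim: x => [|i x IH]; rewrite ?big_nil// big_cons le_max IH orbT.
Qed.

End discrete_norms.

Section pairing.
Context {R : realType} {m : nat}.
Local Notation mR := (measurableTypeR R).
Local Notation vec := 'rV[R]_m.
Local Notation point := (m.-tuple mR * mR)%type.
Implicit Types (d r s p q A : R) (E : {fset vec}) (w i : vec)
  (g : vec -> vec -> R) (y : point) (f h : point -> R).

Lemma mixed_norm_mass d E s g : 0 <= d -> (forall w i, 0 <= g w i) ->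
  mixed_norm d E s%:E 1 (fun w i => (g w i)%:E) = (mass d s E E g `^ s^-1)%:E.
Proof.
move=> d0 g0; rewrite /mixed_norm /net_norm -poweR_EFin; congr (_ `^ _)%E.
rewrite /mass EFinM; congr (_ * _)%E; rewrite -sumEFin; apply: eq_bigr => w _.
rewrite mul1e; under eq_bigr do rewrite poweR_EFin powRr1//.
by rewrite sumEFin !poweR_EFin invr1 powRr1// sumr_ge0.
Qed.

Lemma xray_ge0 d f w i : 0 < d -> (forall y, 0 <= f y) -> (0 <= xray d f w i)%E.
Proof.
move=> d0 f0; rewrite /xray mule_ge0 ?lee_fin ?invr_ge0 ?exprn_ge0 ?(ltW d0)//.
by apply: integral_ge0 => y _; rewrite lee_fin.
Qed.

(** [tube_sum] is the adjoint of [xray]; the factor [d ^+ m] undoes the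
    normalization of the averages. *)
Lemma integral_pairing d E g f : 0 < d -> (forall w i, 0 <= g w i) ->
  measurable_fun setT f -> (forall y, 0 <= f y) ->
  (\int[lebesgue_point]_y (tube_sum d E E g y * f y)%:E =
   \sum_(w <- E) \sum_(i <- E) (d ^+ m * g w i)%:E * xray d f w i)%E.
Proof.
move=> d0 g0 mf f0.
have mterm w i : measurable_fun setT (fun y => (g w i * (\1_(tube d w i) y * f y))%:E).
  apply/measurable_EFinP; apply: measurable_funM => //; apply: measurable_funM => //.
  by apply: measurable_indic; exact: measurable_tube.
have term0 w i y : (0 <= (g w i * (\1_(tube d w i) y * f y))%:E)%E.
  by rewrite lee_fin !mulr_ge0.
transitivity (\int[lebesgue_point]_y (\sum_(w <- E) \sum_(i <- E)
    (g w i * (\1_(tube d w i) y * f y))%:E))%E.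
  apply: eq_integral => y _; rewrite /tube_sum mulr_suml -sumEFin.
  apply: eq_bigr => w _; rewrite mulr_suml -sumEFin; apply: eq_bigr => i _.
  by rewrite mulrA.
rewrite ge0_integral_sum//; last 2 first.
- by move=> w; apply: emeasurable_sum => i; exact: mterm.
- by move=> w y _; apply: sume_ge0.
apply: eq_bigr => w _; rewrite ge0_integral_sum//.
apply: eq_bigr => i _; under eq_integral do rewrite EFinM.
rewrite ge0_integralZl//; last 3 first.
- apply/measurable_EFinP; apply: measurable_funM => //.
  by apply: measurable_indic; exact: measurable_tube.
- by move=> y _; rewrite lee_fin mulr_ge0.
- by rewrite lee_fin.
rewrite /xray muleA -EFinM [_ * d ^- m]mulrAC mulfV ?mul1r ?expf_neq0 ?gt_eqF//.
congr (_ * _)%E; rewrite [RHS]integral_mkcond; apply: eq_integral => y _.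
rewrite patchE indicE; case: ifP => _; first by rewrite mul1r.
by rewrite mul0r.
Qed.

End pairing.

Section duality.
Context {R : realType} {m : nat}.
Local Notation mR := (measurableTypeR R).
Local Notation vec := 'rV[R]_m.
Local Notation point := (m.-tuple mR * mR)%type.
Implicit Types (d r s p q A : R) (E : {fset vec}) (w i : vec)
  (g : vec -> vec -> R) (y : point) (f h : point -> R).

(** The last step of both duality arguments: divide by [S `^ p^-1]. *)
Lemma powR_absorb (S X p r : R) : 0 <= S -> 0 <= X -> 0 < r -> p^-1 + r^-1 = 1 ->
  S <= X * S `^ p^-1 -> S `^ r^-1 <= X.
Proof.
move=> S0 X0 r0 pr; have [->|Sn0] := eqVneq S 0.
  by move=> _; rewrite powR0// invr_eq0 gt_eqF.
have Sp : 0 < S by rewrite lt0r Sn0.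
move=> SX; rewrite -[leLHS](mulfK (lt0r_neq0 (powR_gt0 p^-1 Sp))) -powRD ?Sn0 ?implybT//.
by rewrite addrC pr powRr1// ler_pdivrMr// powR_gt0.
Qed.

Lemma Lnorm_real p f : (forall y, 0 <= f y) ->
  'N[lebesgue_point]_p%:E[EFin \o f]%E =
  ((\int[lebesgue_point]_y (f y `^ p)%:E) `^ p^-1)%E.
Proof.
move=> f0; rewrite unlock /=; congr (_ `^ _)%E; apply: eq_integral => y _.
by rewrite ger0_norm.
Qed.

Lemma mass_hoelder d s q E g (mu : vec -> R) : 0 <= d ->
  (forall w i, 0 <= g w i) -> (forall w, 0 <= mu w) ->
  0 < s -> 0 < q -> q^-1 + s^-1 = 1 ->
  \sum_(w <- E) d ^+ m * (\sum_(i <- E) g w i) * mu w <=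
  mass d s E E g `^ s^-1 * (d ^+ m * \sum_(w <- E) mu w `^ q) `^ q^-1.
Proof.
move=> d0 g0 mu0 s0 q0 qs.
under eq_bigr do rewrite -mulrA.
rewrite -mulr_sumr.
have D0 : 0 <= d ^+ m by rewrite exprn_ge0.
have S0 t (h : vec -> R) : 0 <= \sum_(w <- E) h w `^ t.
  by apply: sumr_ge0 => w _; exact: powR_ge0.
rewrite /mass powRM// powRM// mulrACA -powRD; last first.
  by rewrite addrC qs oner_eq0.
rewrite [s^-1 + _]addrC qs powRr1// ler_wpM2l//.
apply: sum_hoelder => //; last by rewrite addrC.
by move=> w; apply: sumr_ge0.
Qed.

(** Duality: test the estimate for the averages on the power of the sum of
    tubes that is extremal in Hoelder's inequality. *)
Lemma dual_of_kakeya d E p q r s A g : 0 < d -> 0 < p -> 0 < q -> 0 < r -> 0 < s ->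
  p^-1 + r^-1 = 1 -> q^-1 + s^-1 = 1 -> 0 <= A ->
  (forall w, w \in E -> in_cube w) -> (forall w i, 0 <= g w i) ->
  (forall f, measurable_fun setT f -> (forall y, 0 <= f y) ->
    (mixed_norm d E q%:E +oo (xray d f) <=
      A%:E * 'N[lebesgue_point]_p%:E[EFin \o f])%E) ->
  (\int[lebesgue_point]_y (tube_sum d E E g y `^ r)%:E <=
    ((A * mass d s E E g `^ s^-1) `^ r)%:E)%E.
Proof.
move=> d0 p0 q0 r0 s0 pr qs A0 EQ g0 kak.
have D0 : 0 < d ^+ m by rewrite exprn_gt0.
pose F := tube_sum d E E g; have F0 y : 0 <= F y by exact: tube_sum_ge0.
pose S := fine (\int[lebesgue_point]_y (F y `^ r)%:E)%E.
have I0 : (0 <= \int[lebesgue_point]_y (F y `^ r)%:E)%E.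
  by apply: integral_ge0 => y _; rewrite lee_fin powR_ge0.
have SE : (\int[lebesgue_point]_y (F y `^ r)%:E = S%:E)%E.
  rewrite fineK// ge0_fin_numE//.
  refine (le_lt_trans (@integral_tube_sum_le R m d 1 r E E g r0 EQ _ g0) _); last exact: ltry.
  by move=> i /EQ iQ j; rewrite ler_norml; exact: iQ.
have S0 : 0 <= S by rewrite fine_ge0.
rewrite -/F SE lee_fin.
(* then [f `^ p = F `^ r = F * f] *)
pose f y := F y `^ (r - 1).
have f0 y : 0 <= f y by exact: powR_ge0.
have mf : measurable_fun setT f.
  apply: (@measurableT_comp _ _ _ _ _ _ (@powR R ^~ _)) => //.
  exact: measurable_tube_sum.
have rp : (r - 1) * p = r.
  have h1 : p * r * (p^-1 + r^-1) = p * r by rewrite pr mulr1.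
  have h2 : p * r * (p^-1 + r^-1) = r + p by field; rewrite !gt_eqF.
  by rewrite mulrBl mul1r; lra.
have Nf : ('N[lebesgue_point]_p%:E[EFin \o f] = (S `^ p^-1)%:E)%E.
  rewrite Lnorm_real//; under eq_integral do rewrite /f -powRrM rp.
  by rewrite SE poweR_EFin.
have := kak f mf f0; rewrite Nf -EFinM /mixed_norm.
set M := fun w => net_norm 1 E +oo (xray d f w).
have M0 w : (0 <= M w)%E by exact: bigmaxe_ge0.
pose Y := A * S `^ p^-1; have Y0 : 0 <= Y by rewrite mulr_ge0 ?powR_ge0.
rewrite -/Y /net_norm; set Z := (\sum_(w <- E) M w `^ q)%E => HZ.
have Z0 : (0 <= Z)%E by apply: sume_ge0 => w _; exact: poweR_ge0.
have {}HZ : ((d ^+ m)%:E * Z <= (Y `^ q)%:E)%E.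
  have := HZ; move/(gt0_ler_poweR (ltW q0)).
  rewrite !in_itv/= !leey poweR_ge0 lee_fin Y0 => /(_ isT isT).
  by rewrite -poweRrM mulVf ?gt_eqF// poweRe1 ?poweR_EFin// mule_ge0 ?lee_fin// ltW.
have Zfin : (Z < +oo)%E.
  rewrite ltey; apply: contraTneq HZ => ->.
  by rewrite gt0_muley ?lte_fin// leye_eq.
have Mfin w : w \in E -> M w \is a fin_num.
  move=> wE; rewrite ge0_fin_numE//; apply: (@lty_poweRy _ _ q).
    by rewrite gt_eqF.
  apply: le_lt_trans Zfin; rewrite /Z (big_rem w)//= leeDl// sume_ge0// => v _.
  exact: poweR_ge0.
pose mu w := fine (M w); have mu0 w : 0 <= mu w by rewrite fine_ge0.
have {}HZ : d ^+ m * \sum_(w <- E) mu w `^ q <= Y `^ q.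
  rewrite -lee_fin; apply: le_trans HZ; rewrite EFinM lee_wpmul2l ?lee_fin ?(ltW D0)//.
  rewrite -sumEFin /Z big_seq [leRHS]big_seq lee_sum// => w wE.
  by rewrite -[M w]fineK ?Mfin// poweR_EFin.
have key : S <= \sum_(w <- E) d ^+ m * (\sum_(i <- E) g w i) * mu w.
  rewrite -lee_fin -SE.
  under eq_integral do rewrite -mulr_powRB1//.
  rewrite (integral_pairing E d0 g0 mf f0) -sumEFin big_seq [leRHS]big_seq.
  apply: lee_sum => w wE; rewrite -mulrA mulr_suml mulr_sumr -sumEFin.
  rewrite big_seq [leRHS]big_seq lee_sum// => i iE.
  rewrite mulrA [leRHS]EFinM lee_wpmul2l ?lee_fin ?mulr_ge0 ?(ltW D0)//.
  by rewrite /mu fineK ?Mfin//; exact: le_bigmaxe.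
have X0 : 0 <= A * mass d s E E g `^ s^-1 by rewrite mulr_ge0 ?powR_ge0.
have : S `^ r^-1 <= A * mass d s E E g `^ s^-1.
  apply: (powR_absorb S0 X0 r0 pr); apply: (le_trans key).
  have MH := @mass_hoelder d s q E g mu (ltW d0) g0 mu0 s0 q0 qs.
  refine (le_trans MH _).
  rewrite mulrAC [leRHS]mulrC ler_wpM2l ?powR_ge0//.
  rewrite -[leRHS]powRr1// -[X in _ <= _ `^ X](mulfV (lt0r_neq0 q0)) powRrM.
  rewrite ge0_ler_powR ?nnegrE ?invr_ge0 ?(ltW q0) ?powR_ge0//.
  by rewrite mulr_ge0 ?(ltW D0)// sumr_ge0// => w _; exact: powR_ge0.
move=> h; rewrite -[leLHS](powRVK S0 r0).
by rewrite ge0_ler_powR ?nnegrE ?(ltW r0) ?powR_ge0.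
Qed.

(** Conversely, put on each direction the single tube on which the average of
    [f] is largest, with the weight that is extremal in Hoelder's inequality. *)
Lemma kakeya_of_dual d E p q r s D f : 0 < d -> 0 < p -> 0 < q -> 0 < r -> 0 < s ->
  p^-1 + r^-1 = 1 -> q^-1 + s^-1 = 1 -> 0 < D ->
  (forall w, w \in E -> in_cube w) ->
  measurable_fun setT f -> (forall y, 0 <= f y) ->
  (forall g, (forall w i, 0 <= g w i) ->
    (\int[lebesgue_point]_y (tube_sum d E E g y `^ r)%:E <=
     (D * mass d s E E g `^ (r / s))%:E)%E) ->
  (mixed_norm d E q%:E +oo (xray d f) <=
    (D `^ r^-1)%:E * 'N[lebesgue_point]_p%:E[EFin \o f])%E.
Proof.
move=> d0 p0 q0 r0 s0 pr qs D0 EQ mf f0 dual.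
have Dm0 : 0 < d ^+ m by rewrite exprn_gt0.
have [Noo|Nfin] := eqVneq ('N[lebesgue_point]_p%:E[EFin \o f])%E +oo%E.
  by rewrite Noo gt0_muley ?leey// lte_fin powR_gt0.
have N0 : (0 <= 'N[lebesgue_point]_p%:E[EFin \o f])%E by exact: Lnorm_ge0.
pose X := fine ('N[lebesgue_point]_p%:E[EFin \o f])%E.
have XE : ('N[lebesgue_point]_p%:E[EFin \o f] = X%:E)%E.
  by rewrite fineK// ge0_fin_numE// ltey.
have X0 : 0 <= X by rewrite fine_ge0.
have p1 : 1 <= p.
  have ri : 0 < r^-1 by rewrite invr_gt0.
  by rewrite -invf_le1//; lra.
have If : (\int[lebesgue_point]_y (f y `^ p)%:E < +oo)%E.
  by move: Nfin; rewrite Lnorm_real// -ltey => /lty_poweRy; apply; rewrite invr_eq0 gt_eqF.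
have xfin w i : w \in E -> i \in E -> xray d f w i \is a fin_num.
  move=> wE iE; rewrite ge0_fin_numE ?xray_ge0// /xray lte_mul_pinfty//.
    by rewrite lee_fin invr_ge0 ltW.
  have mT := measurable_tube d w i.
  have mfp : measurable_fun setT (fun y => (f y `^ p)%:E).
    apply/measurable_EFinP.
    exact: (@measurableT_comp _ _ _ _ _ _ (@powR R ^~ p)).
  apply: (@le_lt_trans _ _ (\int[lebesgue_point]_(y in tube d w i) (1%:E + (f y `^ p)%:E))%E).
    apply: ge0_le_integral => //.
    - by move=> y _; rewrite lee_fin.
    - by apply/measurable_EFinP; exact: measurable_funTS.
    - by apply: measurable_funTS; apply: emeasurable_funD.
    move=> y _; rewrite -EFinD lee_fin; have [f1|f1] := leP (f y) 1.
      by rewrite (le_trans f1)// lerDl powR_ge0.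
    by rewrite (le_trans (le1r_powR (ltW f1) p1))// lerDr.
  rewrite ge0_integralD//; last 2 first.
  - by move=> y _; rewrite lee_fin powR_ge0.
  - exact: measurable_funTS.
  rewrite integral_cst// mul1e lte_add_pinfty//.
    apply: (@le_lt_trans _ _ (lebesgue_point (slab m (1 + 1 + d)))).
      apply: le_measure; rewrite ?inE//; first exact: measurable_slab.
      move=> y; apply: tube_slab; first exact: EQ.
      by move=> j; rewrite ler_norml; exact: EQ.
    exact: lebesgue_slab.
  apply: le_lt_trans If; apply: ge0_subset_integral => //.
  by move=> y _; rewrite lee_fin powR_ge0.
pose mu w i := fine (xray d f w i).
have mu0 w i : 0 <= mu w i by rewrite fine_ge0// xray_ge0.
have [b bE] : {b : vec -> vec & forall w, w \in E ->
    b w \in E /\ forall i, i \in E -> mu w i <= mu w (b w)}.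
  apply: (@choice _ _ (fun w b => w \in E -> b \in E /\ forall i, i \in E -> mu w i <= mu w b)).
  move=> w; have [wE|wE] := boolP (w \in E); last by exists 0.
  have : enum_fset E != [::].
    by apply/eqP => En; move: wE; rewrite -[w \in E]/(w \in enum_fset E) En.
  by move=> /(seq_argmax (mu w))[i iE imax]; exists i.
pose nu w := mu w (b w).
pose g w i := if i == b w then nu w `^ (q - 1) else 0.
have g0 w i : 0 <= g w i by rewrite /g; case: ifP => // _; exact: powR_ge0.
have sum_g w (h : vec -> R) : w \in E ->
    \sum_(i <- E) g w i * h i = nu w `^ (q - 1) * h (b w).
  move=> wE; have [bwE _] := bE w wE.
  rewrite (bigD1_seq (b w)) ?fset_uniq//= /g eqxx big1 ?addr0// => i /negPf ->.
  by rewrite mul0r.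
pose Z := d ^+ m * \sum_(w <- E) nu w `^ q.
have Z0 : 0 <= Z.
  by rewrite mulr_ge0 ?(ltW Dm0)// sumr_ge0// => w _; exact: powR_ge0.
have qs1 : (q - 1) * s = q.
  have h1 : q * s * (q^-1 + s^-1) = q * s by rewrite qs mulr1.
  have h2 : q * s * (q^-1 + s^-1) = s + q by field; rewrite !gt_eqF.
  by rewrite mulrBl mul1r; lra.
have massE : mass d s E E g = Z.
  rewrite /mass /Z big_seq [in RHS]big_seq; congr (_ * _); apply: eq_bigr => w wE.
  have := sum_g w (fun=> 1) wE; under eq_bigr do rewrite mulr1.
  by move=> ->; rewrite mulr1 -powRrM qs1.
have pairE : (\int[lebesgue_point]_y (tube_sum d E E g y * f y)%:E = Z%:E)%E.
  rewrite integral_pairing// /Z mulr_sumr -sumEFin big_seq [RHS]big_seq.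
  apply: eq_bigr => w wE.
  rewrite -mulr_powRB1 ?mu0// [nu w * _]mulrC -(sum_g w (mu w) wE) mulr_sumr -sumEFin.
  rewrite big_seq [RHS]big_seq; apply: eq_bigr => i iE.
  by rewrite mulrA [RHS]EFinM /mu fineK// xfin.
pose F := tube_sum d E E g.
have F0 y : 0 <= F y by exact: tube_sum_ge0.
have mF : measurable_fun setT F by exact: measurable_tube_sum.
have NF : ('N[lebesgue_point]_r%:E[EFin \o F] <= (D `^ r^-1 * Z `^ s^-1)%:E)%E.
  rewrite Lnorm_real//.
  have -> : (D `^ r^-1 * Z `^ s^-1)%:E = ((D * Z `^ (r / s))%:E `^ r^-1)%E.
    rewrite poweR_EFin (powRM _ (ltW D0) (powR_ge0 Z (r / s))) -powRrM.
    by rewrite mulrAC mulfV ?mul1r ?gt_eqF.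
  have := dual g g0; rewrite massE; apply: gt0_ler_poweR.
  - by rewrite invr_ge0 ltW.
  - rewrite in_itv/= leey andbT; apply: integral_ge0 => y _.
    by rewrite lee_fin powR_ge0.
  - by rewrite in_itv/= leey andbT lee_fin mulr_ge0 ?powR_ge0// ltW.
have ZX : Z <= D `^ r^-1 * X * Z `^ s^-1.
  rewrite -lee_fin -pairE.
  apply: (@le_trans _ _ ('N[lebesgue_point]_1[EFin \o (F \* f)%R])%E).
    rewrite Lnorm1 le_eqVlt; apply/orP; left; apply/eqP/eq_integral => y _ /=.
    by rewrite ger0_norm// mulr_ge0.
  have pr' : r^-1 + p^-1 = 1 by rewrite addrC.
  refine (le_trans (hoelder lebesgue_point mF mf r0 p0 pr') _).
  by rewrite XE mulrAC EFinM lee_wpmul2r// lee_fin.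
have sq' : s^-1 + q^-1 = 1 by rewrite addrC.
have DX0 : 0 <= D `^ r^-1 * X by rewrite mulr_ge0 ?powR_ge0.
have ZqX := powR_absorb Z0 DX0 q0 sq' ZX.
rewrite XE -EFinM; apply: (@le_trans _ _ (Z `^ q^-1)%:E); last by rewrite lee_fin.
rewrite /mixed_norm /net_norm -poweR_EFin.
have h w : w \in E -> (\big[maxe/0%E]_(v <- E) xray d f w v <= (nu w)%:E)%E.
  move=> wE; apply: bigmaxe_le; first by rewrite lee_fin mu0.
  move=> i iE; rewrite -(fineK (xfin w i wE iE)) lee_fin.
  by have [_] := bE w wE; apply.
apply: gt0_ler_poweR; first by rewrite invr_ge0 ltW.
- rewrite in_itv/= leey andbT mule_ge0 ?lee_fin ?(ltW Dm0)// sume_ge0// => w _.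
  exact: poweR_ge0.
- by rewrite in_itv/= leey andbT lee_fin.
rewrite /Z EFinM lee_wpmul2l ?lee_fin ?(ltW Dm0)// -sumEFin big_seq [leRHS]big_seq.
apply: lee_sum => w wE; rewrite -poweR_EFin gt0_ler_poweR ?(ltW q0) ?h//.
- by rewrite in_itv/= leey andbT bigmaxe_ge0.
- by rewrite in_itv/= leey andbT lee_fin mu0.
Qed.

End duality.

(** * The endpoint *)

Section endpoint.
Context {R : realType} {m : nat}.
Local Notation mR := (measurableTypeR R).
Local Notation vec := 'rV[R]_m.
Local Notation point := (m.-tuple mR * mR)%type.
Implicit Types (d e C : R) (p q : \bar R) (E : {fset vec}) (w i : vec)
  (g : vec -> vec -> R) (y : point) (f : point -> R).

Local Notation cm := ((4 * m + 6)%:R ^+ m : R).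

Lemma net_size_le d E : 0 < d <= 1 -> delta_net d E ->
  (size E)%:R * d ^+ m <= cm.
Proof.
move=> d01 netE; apply: separated_cube_size => //.
  exact: delta_net_separated.
by case: netE.
Qed.

Let cm_ge1 : 1 <= cm.
Proof. by rewrite exprn_ege1// ler1n; lia. Qed.

Let cm_ge0 : 0 <= cm. Proof. by apply: le_trans cm_ge1. Qed.

(** The normalized counting measure of a net is at most [(4 * m + 6) ^+ m], so
    the norm of a bounded function is controlled for every exponent. *)
Lemma net_norm_le d E q (M : vec -> \bar R) (Y : R) : (1 <= q)%E ->
  0 < d <= 1 -> delta_net d E -> 0 <= Y ->
  (forall w, w \in E -> (0 <= M w <= Y%:E)%E) ->
  (net_norm (d ^+ m) E q M <= (cm * Y)%:E)%E.
Proof.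
move=> q1 d01 netE Y0 MY; have /andP[d0 _] := d01.
have YcY : Y <= cm * Y by rewrite ler_peMl.
case: q q1 => [q| |//]; last first.
  move=> _; apply: (@le_trans _ _ Y%:E); last by rewrite lee_fin.
  by apply: bigmaxe_le => // w wE; have /andP[] := MY w wE.
rewrite lee_fin => q1; have q0 : 0 < q by apply: lt_le_trans q1.
rewrite /net_norm.
have -> : (cm * Y)%:E = (((cm * Y) `^ q)%:E `^ q^-1)%E.
  by rewrite poweR_EFin -powRrM mulfV ?gt_eqF// powRr1// mulr_ge0.
apply: gt0_ler_poweR; first by rewrite invr_ge0 ltW.
- rewrite in_itv/= leey andbT mule_ge0 ?lee_fin ?exprn_ge0 ?(ltW d0)// sume_ge0// => w _.
  exact: poweR_ge0.
- by rewrite in_itv/= leey andbT lee_fin powR_ge0.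
apply: (@le_trans _ _ ((d ^+ m)%:E * ((size E)%:R * Y `^ q)%:E)%E).
  rewrite lee_wpmul2l ?lee_fin ?exprn_ge0 ?(ltW d0)//.
  apply: (@le_trans _ _ (\sum_(w <- E) (Y `^ q)%:E)%E).
    rewrite big_seq [leRHS]big_seq; apply: lee_sum => w wE.
    have /andP[M0 MwY] := MY w wE; rewrite -poweR_EFin gt0_ler_poweR ?(ltW q0)//.
    - by rewrite in_itv/= leey M0.
    - by rewrite in_itv/= leey lee_fin Y0.
  by rewrite sumEFin lee_fin sum_le_size.
rewrite -EFinM lee_fin mulrA [d ^+ m * _]mulrC powRM//.
rewrite ler_wpM2r ?powR_ge0// (le_trans (net_size_le d01 netE))//.
exact: le1r_powR.
Qed.

Lemma net_norm1 E (h : vec -> R) : (forall i, 0 <= h i) ->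
  net_norm 1 E 1 (fun i => (h i)%:E) = (\sum_(i <- E) h i)%:E.
Proof.
move=> h0; rewrite /net_norm mul1e; under eq_bigr do rewrite poweR_EFin powRr1//.
by rewrite sumEFin poweR_EFin invr1 powRr1// sumr_ge0.
Qed.

(** The [L^1] norm is controlled by the [L^q] norm, as the total mass of the net
    is bounded.  For finite [q], with [N] the norm, this is summing
    [G w <= N + G w `^ q * N `^ (1 - q)]. *)
Lemma sum_le_net_norm d E q (G : vec -> R) : (1 <= q)%E ->
  0 < d <= 1 -> delta_net d E -> (forall w, 0 <= G w) ->
  ((\sum_(w <- E) G w)%:E <=
   ((cm + 1) * d ^- m)%:E * net_norm (d ^+ m) E q (fun w => (G w)%:E))%E.
Proof.
move=> q1 d01 netE G0; have /andP[d0 _] := d01.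
have Dm0 : 0 < d ^+ m by rewrite exprn_gt0.
have sizeE := net_size_le d01 netE.
suff [N [N0 NE SN]] : exists N, [/\ 0 <= N,
    (N%:E <= net_norm (d ^+ m) E q (fun w => (G w)%:E))%E
    & d ^+ m * \sum_(w <- E) G w <= (cm + 1) * N].
  apply: (@le_trans _ _ (((cm + 1) * d ^- m) * N)%:E).
    by rewrite lee_fin mulrAC ler_pdivlMr// mulrC.
  rewrite EFinM lee_wpmul2l// lee_fin.
  by rewrite mulr_ge0 ?addr_ge0 ?invr_ge0 ?(ltW Dm0).
case: q q1 => [q| |//]; last first.
  move=> _; exists (fine (\big[maxe/0]_(w <- E) (G w)%:E)%E).
  have fin : (\big[maxe/0]_(w <- E) (G w)%:E)%E \is a fin_num.
    rewrite ge0_fin_numE ?bigmaxe_ge0//.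
    apply: (@le_lt_trans _ _ (\sum_(w <- E) G w)%:E); last exact: ltry.
    apply: bigmaxe_le => [|w wE]; first by rewrite lee_fin sumr_ge0.
    by rewrite lee_fin (big_rem w)//= lerDl sumr_ge0.
  split; first by rewrite fine_ge0// bigmaxe_ge0.
    by rewrite fineK.
  set N := fine _; have N0 : 0 <= N by rewrite fine_ge0// bigmaxe_ge0.
  apply: (@le_trans _ _ (d ^+ m * ((size E)%:R * N))).
    rewrite ler_wpM2l ?(ltW Dm0)//; apply: sum_le_size => w wE.
    by rewrite -lee_fin fineK//; exact: (@le_bigmaxe _ _ _ (fun w => (G w)%:E)).
  rewrite mulrA [d ^+ m * _]mulrC ler_wpM2r//.
  by rewrite (le_trans sizeE)// lerDl.
rewrite lee_fin => q1; have q0 : 0 < q by apply: lt_le_trans q1.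
pose Z := d ^+ m * \sum_(w <- E) G w `^ q.
have Z0 : 0 <= Z.
  by rewrite mulr_ge0 ?(ltW Dm0)// sumr_ge0// => w _; exact: powR_ge0.
exists (Z `^ q^-1); split; first exact: powR_ge0.
  rewrite /net_norm -poweR_EFin /Z EFinM -sumEFin.
  by under eq_bigr do rewrite -poweR_EFin.
set N := Z `^ q^-1; have N0 : 0 <= N by exact: powR_ge0.
have [Nz|Nn] := eqVneq N 0.
  have Zz : Z = 0 by exact: powR_eq0_eq0 Nz.
  rewrite Nz mulr0 big_seq big1 ?mulr0// => w wE; apply: (@powR_eq0_eq0 _ _ q).
  have /eqP := Zz; rewrite mulf_eq0 (gt_eqF Dm0)/= => /eqP sum0.
  apply/eqP; rewrite eq_le powR_ge0 andbT -sum0 (big_rem w)//= lerDl.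
  by apply: sumr_ge0 => j _; exact: powR_ge0.
have Np : 0 < N by rewrite lt0r Nn.
have ZN : Z = N `^ q by rewrite /N -powRrM mulVf ?gt_eqF// powRr1.
have NN : N `^ q * N `^ (1 - q) = N.
  by rewrite -powRD ?Nn ?implybT// addrC subrK powRr1.
have Gle w : G w <= N + G w `^ q * N `^ (1 - q).
  have [GN|NG] := leP (G w) N.
    by rewrite (le_trans GN)// lerDl mulr_ge0 ?powR_ge0.
  have Gp : 0 < G w by apply: lt_trans NG.
  apply: (@le_trans _ _ (G w `^ q * N `^ (1 - q))); last by rewrite lerDr.
  rewrite -[1 - q]opprB powRN ler_pdivlMr ?(powR_gt0 _ Np)//.
  rewrite -[leRHS]mulr_powRB1// ler_wpM2l// ge0_ler_powR ?nnegrE ?subr_ge0//.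
  exact: ltW.
apply: (@le_trans _ _ (d ^+ m * \sum_(w <- E) (N + G w `^ q * N `^ (1 - q)))).
  by rewrite ler_wpM2l ?(ltW Dm0)// ler_sum.
rewrite big_split/= -mulr_suml mulrDr mulrA -/Z ZN NN mulrDl mul1r lerD2r.
rewrite big_const_seq count_predT iter_addr_0 -[N *+ _]mulr_natl mulrA.
by rewrite ler_wpM2r// mulrC.
Qed.

Lemma Lnorm_infty_le f (c : \bar R) : (0 <= c)%E -> (forall y, (`|(f y)%:E| <= c)%E) ->
  ('N[lebesgue_point]_+oo [EFin \o f] <= c)%E.
Proof.
move=> c0 fc; rewrite unlock; case: ifP => // _.
by apply/ess_supP; apply: aeW => y /=; exact: fc.
Qed.

End endpoint.

Section endpoint_estimates.
Context {R : realType} {m : nat}.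
Implicit Types (q : \bar R).

Lemma fine_inv1 : fine ((1 : \bar R)^-1)%E = 1 :> R.
Proof. by rewrite inver oner_eq0 invr1. Qed.

Lemma powR_eps_ge1 (d e : R) : 0 < d <= 1 -> 0 <= e -> 1 <= d `^ (- e).
Proof. by move=> d01 e0; rewrite -(powRr0 d) ger_powR// oppr_le0. Qed.

(** The average over a tube is at most [d ^- m] times the whole integral, and
    [d ^- m] is the power of the scale allowed for [p = 1]. *)
Lemma kakeya_endpoint q : (1 <= q)%E -> kakeya_estimate m.+1 1 q.
Proof.
move=> q1; exists 1 => // e e0; exists ((4 * m + 6)%:R ^+ m).
  by rewrite exprn_gt0// ltr0n; lia.
move=> d E /andP[d0 d1] netE f mf f0; rewrite fine_inv1.
have d01 : 0 < d <= 1 by rewrite d0 ltW.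
have N0 : (0 <= 'N[lebesgue_point]_1[EFin \o f])%E by exact: Lnorm_ge0.
have c0 : 0 < (4 * m + 6)%:R ^+ m :> R by rewrite exprn_gt0// ltr0n; lia.
have dE : d `^ (1 - m.+1%:R * 1) = d ^- m.
  by rewrite mulr1 -addn1 natrD opprD addrCA subrr addr0 powR_invn// ltW.
have [Noo|Nfin] := eqVneq ('N[lebesgue_point]_1[EFin \o f])%E +oo%E.
  by rewrite Noo gt0_muley ?leey// lte_fin !mulr_gt0// powR_gt0.
pose X := fine ('N[lebesgue_point]_1[EFin \o f])%E.
have XE : ('N[lebesgue_point]_1[EFin \o f] = X%:E)%E.
  by rewrite fineK// ge0_fin_numE// ltey.
have X0 : 0 <= X by rewrite fine_ge0.
have xX w i : (xray d f w i <= (d ^- m * X)%:E)%E.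
  rewrite /xray EFinM lee_wpmul2l ?lee_fin ?invr_ge0 ?exprn_ge0 ?(ltW d0)//.
  rewrite -XE Lnorm1.
  have -> : (\int[lebesgue_point]_y `|(EFin \o f) y| =
      \int[lebesgue_point]_y (f y)%:E)%E.
    by apply: eq_integral => y _ /=; rewrite ger0_norm.
  apply: ge0_subset_integral => //; first exact: measurable_tube.
    exact/measurable_EFinP.
  by move=> y _; rewrite lee_fin.
have dX0 : 0 <= d ^- m * X by rewrite mulr_ge0// invr_ge0 exprn_ge0// ltW.
refine (le_trans (net_norm_le q1 d01 netE dX0 _) _).
  move=> w wE; rewrite bigmaxe_ge0/=; apply: bigmaxe_le => //.
rewrite XE dE -EFinM lee_fin -!mulrA ler_pM2l//.
rewrite ler_peMl//.
exact: powR_eps_ge1 d01 (ltW e0).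
Qed.

(** A sum of tubes is at most the sum of the weights, which [sum_le_net_norm]
    bounds by [d ^- m] times the mixed norm. *)
Lemma bilinear_endpoint q : (1 <= q)%E -> bilinear_kakeya_estimate m.+1 1 q.
Proof.
move=> q1; rewrite /bilinear_kakeya_estimate.
have -> : (hoelder_conjugate 1%:E / 2%:E = +oo :> \bar R)%E.
  by rewrite hoelder_conjugate1 inver pnatr_eq0/= gt0_mulye// lte_fin invr_gt0.
have s1 := hoelder_conj_ge1 q1; set s := hoelder_conjugate q in s1 *.
exists 1 => // c e c0 e0.
pose a : R := (4 * m + 6)%:R ^+ m + 1.
have a0 : 0 < a by rewrite ltr_pwDr// exprn_ge0.
exists (a ^+ 2); first by rewrite exprn_gt0.
move=> d E E1 E2 /andP[d0 d1] netE _ _ _ f g f0 g0 _ _; rewrite fine_inv1.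
have d01 : 0 < d <= 1 by rewrite d0 ltW.
have sumle h : (forall w i, 0 <= h w i) -> forall y,
    ((xray_adj d E h y)%:E <= (a * d ^- m)%:E *
      mixed_norm d E s 1 (fun w i => (h w i)%:E))%E.
  move=> h0 y; rewrite /mixed_norm.
  have -> : (fun w => net_norm 1 E 1 (fun i => (h w i)%:E)) =
      (fun w => (\sum_(i <- E) h w i)%:E).
    by apply/funext => w; rewrite net_norm1.
  apply: (le_trans _ (sum_le_net_norm (G := fun w => \sum_(i <- E) h w i) s1 d01 netE _)).
    by rewrite lee_fin; exact: tube_sum_le.
  by move=> w; apply: sumr_ge0.
have adj0 h y : (forall w i, 0 <= h w i) -> 0 <= xray_adj d E h y.
  exact: tube_sum_ge0.
have norm0 h : (forall w i, 0 <= h w i) ->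
    (0 <= mixed_norm d E s 1 (fun w i => (h w i)%:E))%E.
  move=> h0; rewrite /mixed_norm /net_norm; case: (s) => [t| |];
    [exact: poweR_ge0|exact: bigmaxe_ge0|].
  exact: bigmaxe_ge0.
have dE : d `^ (2 - 2 * m.+1%:R * 1) = d ^- m * d ^- m.
  rewrite -powR_invn ?(ltW d0)// -powRD; last by rewrite (gt_eqF d0) implybT.
  by congr (_ `^ _); rewrite -addn1 natrD; ring.
have B0 : 0 <= a ^+ 2 * d `^ (- e) * (d ^- m * d ^- m).
  by rewrite !mulr_ge0 ?powR_ge0 ?exprn_ge0 ?invr_ge0 ?exprn_ge0 ?(ltW a0) ?(ltW d0).
rewrite dE; apply: Lnorm_infty_le.
  by rewrite !mule_ge0 ?norm0.
move=> y; rewrite abse_EFin ger0_norm ?mulr_ge0 ?adj0// EFinM.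
apply: (@le_trans _ _ ((a * d ^- m)%:E * mixed_norm d E s 1 (fun w i => (f w i)%:E) *
   ((a * d ^- m)%:E * mixed_norm d E s 1 (fun w i => (g w i)%:E)))%E).
  by apply: lee_pmul; rewrite ?lee_fin ?adj0// sumle.
rewrite muleACA -[leRHS]muleA lee_wpmul2r ?mule_ge0 ?norm0// -EFinM lee_fin.
rewrite mulrACA -expr2 ler_wpM2r// ?mulr_ge0 ?invr_ge0 ?exprn_ge0 ?(ltW d0)//.
by rewrite ler_peMr ?exprn_ge0 ?(ltW a0)// powR_eps_ge1// ltW.
Qed.

End endpoint_estimates.

(** * The equivalence *)

Section equivalence.
Context {R : realType} {m : nat}.
Local Notation mR := (measurableTypeR R).
Local Notation vec := 'rV[R]_m.
Local Notation point := (m.-tuple mR * mR)%type.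
Implicit Types (p q r s : R) (F G : point -> R).

Lemma hoelder_conjugateE p : 1 < p -> hoelder_conjugate p%:E = (p / (p - 1))%:E.
Proof.
move=> p1; rewrite /hoelder_conjugate/= eqe gt_eqF ?(lt_trans ltr01)//.
by rewrite -EFinD inver subr_eq0 gt_eqF.
Qed.

(** Cauchy-Schwarz for [F `^ (r / 2)] and [G `^ (r / 2)]; it gives Hoelder's
    inequality with exponents [r] and [r] also when [r / 2 < 1]. *)
Lemma Lnorm_half r F G (a b : R) : 0 < r -> 0 <= a -> 0 <= b ->
  measurable_fun setT F -> measurable_fun setT G ->
  (forall y, 0 <= F y) -> (forall y, 0 <= G y) ->
  (\int[lebesgue_point]_y (F y `^ r)%:E <= (a `^ r)%:E)%E ->
  (\int[lebesgue_point]_y (G y `^ r)%:E <= (b `^ r)%:E)%E ->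
  ('N[lebesgue_point]_(r / 2)%:E[(fun y => (F y * G y)%:E)] <= (a * b)%:E)%E.
Proof.
move=> r0 a0 b0 mF mG F0 G0 Fa Gb; have r2 : 0 < r / 2 by rewrite divr_gt0.
have mh (H : point -> R) : measurable_fun setT H ->
    measurable_fun setT (fun y => H y `^ (r / 2)).
  by move=> mH; exact: (@measurableT_comp _ _ _ _ _ _ (@powR R ^~ (r / 2))).
have N2 (H : point -> R) c : 0 <= c -> (forall y, 0 <= H y) ->
    (\int[lebesgue_point]_y (H y `^ r)%:E <= (c `^ r)%:E)%E ->
    ('N[lebesgue_point]_2%:E[EFin \o (fun y => H y `^ (r / 2))%R] <= (c `^ (r / 2))%:E)%E.
  move=> c0 H0 Hc; rewrite Lnorm_real; last by move=> y; exact: powR_ge0.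
  under eq_integral do rewrite -powRrM divfK//.
  have -> : (c `^ (r / 2))%:E = ((c `^ r)%:E `^ 2^-1)%E.
    by rewrite poweR_EFin -powRrM.
  apply: gt0_ler_poweR Hc; first by rewrite invr_ge0.
    by rewrite in_itv/= leey andbT; apply: integral_ge0 => y _; rewrite lee_fin powR_ge0.
  by rewrite in_itv/= leey andbT lee_fin powR_ge0.
have FG0 y : 0 <= F y * G y by rewrite mulr_ge0.
rewrite [X in (X <= _)%E](_ : _ =
    ((\int[lebesgue_point]_y ((F y * G y) `^ (r / 2))%:E) `^ (r / 2)^-1)%E);
  last exact: (Lnorm_real _ FG0).
have -> : (a * b)%:E = (((a `^ (r / 2)) * (b `^ (r / 2)))%:E `^ (r / 2)^-1)%E.
  by rewrite -powRM// poweR_EFin -powRrM mulfV ?gt_eqF// powRr1// mulr_ge0.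
have hh : 2^-1 + 2^-1 = 1 :> R by lra.
have step : (\int[lebesgue_point]_y ((F y * G y) `^ (r / 2))%:E <=
    ((a `^ (r / 2)) * (b `^ (r / 2)))%:E)%E.
  apply: (@le_trans _ _ ('N[lebesgue_point]_1[EFin \o
      ((fun y => F y `^ (r / 2)) \* (fun y => G y `^ (r / 2)))%R])%E).
    rewrite Lnorm1 le_eqVlt; apply/orP; left; apply/eqP/eq_integral => y _ /=.
    by rewrite powRM// ger0_norm// mulr_ge0 ?powR_ge0.
  have H := hoelder lebesgue_point (mh F mF) (mh G mG) (ltr0Sn R 1) (ltr0Sn R 1) hh.
  refine (le_trans H _); rewrite EFinM.
  by apply: lee_pmul; rewrite ?Lnorm_ge0//; exact: N2.
apply: gt0_ler_poweR step; first by rewrite invr_ge0 ltW.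
  by rewrite in_itv/= leey andbT; apply: integral_ge0 => y _; rewrite lee_fin powR_ge0.
by rewrite in_itv/= leey andbT lee_fin mulr_ge0 ?powR_ge0.
Qed.

Lemma powRM3 (a b c t : R) : 0 <= a -> 0 <= b -> 0 <= c ->
  (a * b * c) `^ t = a `^ t * b `^ t * c `^ t.
Proof. by move=> a0 b0 c0; rewrite !powRM// mulr_ge0. Qed.

Lemma fine_invE p : p != 0 -> fine (p%:E^-1)%E = p^-1.
Proof. by move=> p0; rewrite inver (negbTE p0). Qed.

Lemma half_EFin r : (r%:E / 2%:E)%E = (r / 2)%:E.
Proof. by rewrite inver pnatr_eq0. Qed.

Lemma hoelder_conj_real p : 1 < p ->
  [/\ 0 < p, 0 < p / (p - 1), 1 < p / (p - 1) & p^-1 + (p / (p - 1))^-1 = 1].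
Proof.
move=> p1; have p0 : 0 < p by apply: lt_trans p1.
have pm : 0 < p - 1 by rewrite subr_gt0.
split => //; first by rewrite divr_gt0.
  by rewrite ltr_pdivlMr// mul1r; lra.
by rewrite invf_div; field; rewrite gt_eqF.
Qed.

Lemma bilinear_of_kakeya p q : 1 < p -> 1 < q ->
  kakeya_estimate m.+1 p%:E q%:E -> bilinear_kakeya_estimate m.+1 p%:E q%:E.
Proof.
move=> p1 q1; rewrite /bilinear_kakeya_estimate /kakeya_estimate !hoelder_conjugateE//.
have [p0 r0 r1 pr] := hoelder_conj_real p1.
have [q0 s0 s1 qs] := hoelder_conj_real q1.
set r := p / (p - 1) in r0 r1 pr *; set s := q / (q - 1) in s0 s1 qs *.
rewrite (fine_invE (lt0r_neq0 p0)) => -[delta0 delta00 kak]; exists delta0 => // c e c0 e0.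
have e20 : 0 < e / 2 by rewrite divr_gt0.
have [C C0 {}kak] := kak (e / 2) e20; exists (C ^+ 2); first by rewrite exprn_gt0.
move=> d E E1 E2 /andP[d0 dd0] netE _ _ _ f g f0 g0 _ _.
have d0' := ltW d0.
rewrite half_EFin.
set A := C * d `^ (- (e / 2)) * d `^ (1 - m.+1%:R * p^-1).
have A0 : 0 <= A by rewrite !mulr_ge0 ?powR_ge0// ltW.
have EQ w : w \in E -> in_cube w by case: netE => h _ _ /h.
have kakE (h : point -> R) : measurable_fun setT h -> (forall y, 0 <= h y) ->
    (mixed_norm d E q%:E +oo (xray d h) <= A%:E * 'N[lebesgue_point]_p%:E[EFin \o h])%E.
  by move=> mh h0; apply: kak => //; rewrite d0.
have dual h (h0 : forall w i, 0 <= h w i) :=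
  dual_of_kakeya d0 p0 q0 r0 s0 pr qs A0 EQ h0 kakE.
rewrite (mixed_norm_mass E s d0' f0) (mixed_norm_mass E s d0' g0).
have mF h := @measurable_tube_sum R m d E E h.
have X0 h : 0 <= A * mass d s E E h `^ s^-1 by rewrite mulr_ge0 ?powR_ge0.
have F0 h : (forall w i, 0 <= h w i) -> forall y, 0 <= tube_sum d E E h y.
  by move=> h0 y; exact: tube_sum_ge0.
refine (le_trans (Lnorm_half r0 (X0 f) (X0 g) (mF f) (mF g)
  (F0 f f0) (F0 g g0) (dual f f0) (dual g g0)) _).
rewrite -!EFinM lee_fin mulrACA -[leRHS]mulrA.
rewrite [X in _ <= X * _](_ : _ = A * A)// /A.
have -> : - e = - (e / 2) + - (e / 2) by lra.
have -> : 2 - 2 * m.+1%:R * p^-1 = (1 - m.+1%:R * p^-1) + (1 - m.+1%:R * p^-1) by ring.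
by rewrite !powRD ?(gt_eqF d0) ?implybT//; ring.
Qed.

(** The critical power of the scale is [kappa = r * (1 - n / p)], and
    [kappa + m * (r / s) = m + 1 - m * r / q]: the inequality required by the
    induction on scales is [q <= m * r]. *)
Lemma kakeya_of_bilinear p q : 1 < p -> p <= q -> q <= m%:R * (p / (p - 1)) ->
  bilinear_kakeya_estimate m.+1 p%:E q%:E -> kakeya_estimate m.+1 p%:E q%:E.
Proof.
move=> p1 pq qm; rewrite /bilinear_kakeya_estimate.
have q1 : 1 < q by apply: lt_le_trans pq.
rewrite !hoelder_conjugateE//.
have [p0 r0 r1 pr] := hoelder_conj_real p1.
have [q0 s0 s1 qs] := hoelder_conj_real q1.
set r := p / (p - 1) in r0 r1 pr qm *; set s := q / (q - 1) in s0 s1 qs *.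
rewrite half_EFin /kakeya_estimate (fine_invE (lt0r_neq0 p0)) => -[delta0 delta00 bil].
exists 1 => // e e0.
pose kappa := r * (1 - m.+1%:R * p^-1).
have sr : s <= r.
  have : r^-1 <= s^-1.
    have : q^-1 <= p^-1 by rewrite lef_pV2 ?posrE.
    by lra.
  by rewrite lef_pV2 ?posrE.
have hk : kappa + m%:R * (r / s) <= m%:R.
  have rp : r * p^-1 = r - 1.
    have : r * (p^-1 + r^-1) = r by rewrite pr mulr1.
    by rewrite mulrDr mulfV ?gt_eqF//; lra.
  have -> : kappa + m%:R * (r / s) = m%:R + (1 - m%:R * r * q^-1).
    have -> : s^-1 = 1 - q^-1 by lra.
    rewrite /kappa mulrBr mulr1 mulrCA rp -addn1 natrD; ring.
  have : 1 <= m%:R * r * q^-1 by rewrite ler_pdivlMr// mul1r.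
  by lra.
have bilE c e1 : 0 < c -> 0 < e1 -> exists2 B, 0 < B & forall d, 0 < d < delta0 ->
    @bilinear_estimate R m d c r s (B * d `^ (- e1) * d `^ kappa).
  move=> c0 e10; have ee : 0 < 2 * e1 / r by apply: divr_gt0 => //; apply: mulr_gt0.
  (* raising to the power [r / 2] turns the loss [2 * e1 / r] into [e1] *)
  have [C C0 {}bil] := bil c (2 * e1 / r) c0 ee.
  exists (C `^ (r / 2)); first by rewrite powR_gt0.
  move=> d /andP[d0 dd] E E1 E2 netE s1E s2E sep f g f0 g0 sf sg.
  have := bil d E E1 E2 _ netE s1E s2E sep f g f0 g0 sf sg.
  rewrite d0 dd => /(_ isT).
  rewrite (mixed_norm_mass E s (ltW d0) f0) (mixed_norm_mass E s (ltW d0) g0).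
  set D := C * _ * _; set Mf := mass _ _ _ _ f; set Mg := mass _ _ _ _ g => bound.
  have D0 : 0 <= D by rewrite !mulr_ge0 ?powR_ge0// ltW.
  have Mf0 : 0 <= Mf by apply: mass_ge0; exact: ltW.
  have Mg0 : 0 <= Mg by apply: mass_ge0; exact: ltW.
  have r20 : 0 < r / 2 by rewrite divr_gt0.
  have FG0 y : 0 <= tube_sum d E E f y * tube_sum d E E g y.
    by apply: mulr_ge0; exact: tube_sum_ge0.
  have -> : (\int[lebesgue_point]_y ((tube_sum d E E f y * tube_sum d E E g y) `^ (r / 2))%:E
      = 'N[lebesgue_point]_(r / 2)%:E[
        (fun y => (tube_sum d E E f y * tube_sum d E E g y)%:E)] `^ (r / 2))%E.
    rewrite (poweR_Lnorm _ _ (lt0r_neq0 r20)); apply: eq_integral => y _.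
    by rewrite abse_EFin ger0_norm// poweR_EFin.
  apply: (@le_trans _ _ ((D * Mf `^ s^-1 * Mg `^ s^-1)%:E `^ (r / 2))%E).
    move: bound; rewrite -!EFinM; apply: gt0_ler_poweR; first exact: ltW.
    - by rewrite in_itv/= leey andbT Lnorm_ge0.
    - rewrite in_itv/= leey andbT lee_fin.
      exact: mulr_ge0 (mulr_ge0 D0 (powR_ge0 _ _)) (powR_ge0 _ _).
  rewrite poweR_EFin lee_fin le_eqVlt; apply/orP; left; apply/eqP.
  rewrite -mulrA (powRM _ D0 (mulr_ge0 (powR_ge0 _ _) (powR_ge0 _ _))).
  rewrite -(powRM _ Mf0 Mg0) -powRrM /D.
  rewrite (powRM3 _ (ltW C0) (powR_ge0 d _) (powR_ge0 d _)).
  rewrite -[(d `^ (- _)) `^ _]powRrM -[(d `^ (2 - _)) `^ _]powRrM.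
  rewrite (_ : - (2 * e1 / r) * (r / 2) = - e1); last by field; rewrite gt_eqF.
  rewrite (_ : (2 - 2 * m.+1%:R * p^-1) * (r / 2) = kappa); last first.
    by rewrite /kappa; field; rewrite gt_eqF.
  by rewrite (_ : s^-1 * (r / 2) = r / s / 2)//; ring.
have re0 : 0 < r * e by rewrite mulr_gt0.
have s1r : 1 <= s <= r by rewrite sr ltW.
have [C C0 est] := dual_estimate_of_bilinear r0 s1r delta00 hk bilE re0.
exists (C `^ r^-1); first by rewrite powR_gt0.
move=> d E /andP[d0 d1] netE f mf f0.
have d01 : 0 < d <= 1 by rewrite d0 ltW.
pose D := C * d `^ (- (r * e)) * d `^ kappa.
have D0 : 0 < D by rewrite !mulr_gt0 ?powR_gt0.
have EQ w : w \in E -> in_cube w by case: netE => h _ _ /h.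
have sepE := delta_net_separated netE.
have dual g : (forall w i, 0 <= g w i) ->
    (\int[lebesgue_point]_y (tube_sum d E E g y `^ r)%:E <=
     (D * mass d s E E g `^ (r / s))%:E)%E.
  by move=> g0; apply: est.
have := kakeya_of_dual d0 p0 q0 r0 s0 pr qs D0 EQ mf f0 dual.
have -> // : D `^ r^-1 = C `^ r^-1 * d `^ (- e) * d `^ (1 - m.+1%:R * p^-1).
rewrite /D (powRM3 _ (ltW C0) (powR_ge0 d _) (powR_ge0 d _)).
rewrite -[(d `^ (- _)) `^ _]powRrM -[(d `^ kappa) `^ _]powRrM.
rewrite (_ : - (r * e) * r^-1 = - e); last by field; rewrite gt_eqF.
rewrite (_ : kappa * r^-1 = 1 - m.+1%:R * p^-1)//.
by rewrite /kappa; field; rewrite !gt_eqF.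
Qed.

End equivalence.

Unset Implicit Arguments.

Theorem theorem3p1 (R : realType) (n : nat) (p q : \bar R)
    (n_ge2 : (2 <= n)%N) (p_ge1 : (1 <= p)%E) (p_le_q : (p <= q)%E)
    (q_le : (q <= (n%:R - 1)%:E * hoelder_conjugate p)%E) :
  kakeya_estimate n p q <-> bilinear_kakeya_estimate n p q.
Proof.
case: n n_ge2 q_le => // m _ q_le.
have q_ge1 : (1 <= q)%E by apply: le_trans p_le_q.
move: p_ge1; rewrite le_eqVlt => /predU1P[<-|p_gt1].
  by split => _; [exact: bilinear_endpoint|exact: kakeya_endpoint].
case: p => [p| |//] in p_le_q q_le p_gt1 *; last first.
  by move: q_le; rewrite hoelder_conjugatey mule1 leye_eq in p_le_q *; move/eqP: p_le_q => ->.
have p1 : 1 < p by rewrite -lte_fin.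
move: q_le; rewrite hoelder_conjugateE// -EFinM.
case: q => [q| |//] in p_le_q q_ge1 *; last by rewrite leye_eq.
rewrite !lee_fin -addn1 natrD addrK addn1 in p_le_q * => q_le.
have q1 : 1 < q by apply: lt_le_trans p_le_q.
by split; [exact: bilinear_of_kakeya|exact: kakeya_of_bilinear].
Qed.
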